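(* Let $a_0,a_1,c_0,c_1$ be non-negative integers, $\alpha,\beta\in\binom{[a_0+a_1]}{a_1}$ and $\gamma,\delta\in\binom{[c_0+c_1]}{c_1}$. Then the number $\mathrm{Par}(\alpha,\gamma,\beta,\delta)$ of parallelogram-shaped puzzles with SW, NW, NE, SE labels $\alpha,\gamma,\beta,\delta$ is $$\mathrm{Par}(\alpha,\gamma,\beta,\delta)=\begin{cases}\displaystyle\sum_{\mu} c_{\alpha,\beta}^{\mu 1^{a_1-c_1}0^{a_0-c_0}}\cdot c_{\gamma,\delta}^{\mu^\vee} & \text{if } a_0\ge c_0 \text{ and } a_1>c_1,\\[2mm] \displaystyle\sum_{\lambda} c_{\alpha,\beta}^{\lambda^\vee}\cdot c_{\gamma,\delta}^{1^{c_1-a_1}0^{c_0-a_0}\lambda} & \text{if } c_1\ge a_1\text{ and } c_0>a_0,\\[2mm] \displaystyle\sum_{\eta} c_{\alpha,\beta}^{\eta^\vee 0^{a_0-c_0}}\cdot c_{\gamma,\delta}^{1^{c_1-a_1}\eta} & \text{if } a_0\ge c_0\text{ and } c_1\ge a_1,\\[2mm] 0 & \text{if } c_0>a_0\text{ and } a_1>c_1,\end{cases}$$ where the sums run over $\mu\in\binom{[c_0+c_1]}{c_1}$, over $\lambda\in\binom{[a_0+a_1]}{a_1}$, and over $\eta\in\binom{[c_0+a_1]}{a_1}$, respectively.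
   Context: Strings: $\binom{[n]}{k}$ denotes the set of binary strings (words in $0,1$) of length $n$ with exactly $k$ ones; juxtaposition is concatenation; $0^m,1^m$ are constant strings of length $m$; $\lambda^\vee$ is the reversal of $\lambda$. Littlewood-Richardson numbers: for $\lambda,\mu,\nu\in\binom{[n]}{k}$, $c_{\lambda,\mu}^\nu$ is defined by $[X_\lambda][X_\mu]=\sum_{\nu\in\binom{[n]}{k}}c_{\lambda,\mu}^\nu[X_\nu]$ in $H^*(\mathrm{Gr}(k;\mathbb{C}^n))$, where $X_\lambda=\{V:\dim(V\cap\langle e_1,\dots,e_i\rangle)\ge\lambda_1+\dots+\lambda_i\ \forall i\}$ is a Schubert variety (of codimension the number of inversions $i<j$, $\lambda_i=1,\lambda_j=0$). Equivalently it is the usual Littlewood-Richardson coefficient of the partitions attached to the strings, the partition of $\lambda$ having as its $j$-th part the number of $0$s to the right of the $j$-th $1$ in $\lambda$. Puzzles: work in the triangular lattice in the plane, whose unit edges make angles $0^\circ,60^\circ,120^\circ$ with the $x$-axis. Edge labels are the three symbols $0$, $1$, $10$ (where $10$ is a single symbol). A unit triangle (upward- or downward-pointing) with labeled edges is an allowed piece if its three labels read clockwise are $(0,0,0)$, $(1,1,1)$, or a cyclic rotation of $(1,0,10)$. Given a convex lattice polygon (sides along lattice directions, some sides possibly of length $0$) each of whose sides is labeled by a binary string, one symbol per unit edge, read clockwise around the polygon, a puzzle with this boundary is an assignment of labels to all unit lattice edges in the polygon which agrees with the prescribed labels on the boundary and for which every unit triangle in the polygon is an allowed piece. $\mathrm{Par}(\alpha,\gamma,\beta,\delta)$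 is the number of puzzles on the parallelogram with sides, in clockwise order, SW (length $a_0+a_1$), NW (length $c_0+c_1$), NE (length $a_0+a_1$), SE (length $c_0+c_1$), with top and bottom angles $60^\circ$, labeled respectively $\alpha,\gamma,\beta,\delta$, each read clockwise. *)

(* Defs.v *)
From HB Require Import structures.
From mathcomp Require Import all_boot all_order all_algebra.
From mathcomp Require Import finmap mpoly.
From Stdlib Require Import ClassicalEpsilon.

Set Implicit Arguments.
Unset Strict Implicit.
Unset Printing Implicit Defensive.

Import GRing.Theory.

Local Open Scope ring_scope.

Definition binstr (n k : nat) : pred (seq bool) :=
  [pred s | (size s == n) && (count id s == k)].

(* The partition whose j-th part is the number of 0s to the right of the j-th
   1 of s. *)
Fixpoint part_of_str (s : seq bool) : seq nat :=
  if s is b :: s' then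
    if b then count negb s' :: part_of_str s' else part_of_str s'
  else [::].

(* Schur polynomials in k variables, as ratios of alternants
   det (x_i^(la_j + k - j)) / det (x_i^(k - j)), 1 <= i, j <= k; the quotient
   is taken in the field of fractions of Z[x_1, ..., x_k]. *)
Definition alternant (k : nat) (la : seq nat) : {mpoly int[k]} :=
  \det (\matrix_(i < k, j < k) 'X_i ^+ (nth 0 la j + (k - j.+1))%N).

Definition schur (k : nat) (la : seq nat) : {fraction {mpoly int[k]}} :=
  tofrac (alternant k la) / tofrac (alternant k [::]).

(* s_la s_mu = \sum_nu c_nu s_nu, where nu runs over the partitions with at
   most k parts, written with exactly k parts by padding with zeros. *)
Definition schur_product_expansion (k : nat) (la mu : seq nat)
    (c : {fsfun seq nat -> int with 0}) : Prop :=
  {in finsupp c, forall nu, size nu = k /\ sorted geq nu} /\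
  schur k la * schur k mu = \sum_(nu <- finsupp c) (c nu)%:~R * schur k nu.

(* The Schur polynomials indexed by these partitions form a Z-basis of the
   symmetric polynomials, so the expansion exists and is unique, and epsilon
   selects it. *)
Definition lr_coef (k : nat) (la mu nu : seq nat) : int :=
  epsilon (inhabits [fsfun]) (schur_product_expansion k la mu) nu.

(* The number c_{la, mu}^nu for strings la, mu, nu of the same length with
   exactly k ones. *)
Definition lr_str (k : nat) (la mu nu : seq bool) : int :=
  lr_coef k (part_of_str la) (part_of_str mu) (part_of_str nu).

(* Edge labels: Some false is 0, Some true is 1, None is the symbol 10. *)
Definition label : finType := option bool.

(* The labels of the three edges of a unit triangle, read clockwise. *)
Definition allowed_piece (x y z : label) : bool :=
  (x, y, z) \in [:: (Some false, Some false, Some false);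
                    (Some true, Some true, Some true);
                    (Some true, Some false, None);
                    (Some false, None, Some true);
                    (None, Some true, Some false)].

(* The lattice points of the parallelogram are i u + j v, 0 <= i <= c,
   0 <= j <= a, with the west corner as origin and u, v the unit vectors at
   angles 60 and -60 degrees, so that the top and bottom angles are 60 degrees,
   the SW and NE sides have direction v and the NW and SE sides direction u.
   The unit edges are labeled by
     U i j  for the edge from i u + j v to (i + 1) u + j v,
     V i j  for the edge from i u + j v to i u + (j + 1) v,
     H i j  for the horizontal edge from i u + j v to (i + 1) u + (j + 1) v.
   The latter splits the unit rhombus with west corner i u + j v into an upward
   triangle (left, right and bottom edges U i j, V i+1 j, H i j) and a downward
   one (top, right and left edges H i j, U i j+1, V i j). *)
Definition all_pieces_allowed (a c : nat) (U : 'M[label]_(c, a.+1))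
    (V : 'M[label]_(c.+1, a)) (H : 'M[label]_(c, a)) : bool :=
  [forall i : 'I_c, forall j : 'I_a,
     let i0 := widen_ord (leqnSn c) i in let i1 := lift ord0 i in
     let j0 := widen_ord (leqnSn a) j in let j1 := lift ord0 j in
     allowed_piece (U i j0) (V i1 j) (H i j) &&
     allowed_piece (H i j) (U i j1) (V i0 j)].

(* Reading clockwise, the SW side goes from the bottom corner to the west one,
   and the SE side from the east corner to the bottom one: both against the
   direction of the coordinates. *)
Definition boundary_is (a c : nat) (U : 'M[label]_(c, a.+1))
    (V : 'M[label]_(c.+1, a)) (SW NW NE SE : seq bool) : bool :=
  [&& rev [seq V ord0 j | j <- enum 'I_a] == map Some SW,
      [seq U i ord0 | i <- enum 'I_c] == map Some NW,
      [seq V ord_max j | j <- enum 'I_a] == map Some NE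
    & rev [seq U i ord_max | i <- enum 'I_c] == map Some SE].

Definition par_puzzles (a c : nat) (SW NW NE SE : seq bool) :
    {set 'M[label]_(c, a.+1) * 'M[label]_(c.+1, a) * 'M[label]_(c, a)} :=
  [set P | let: (U, V, H) := P in
           all_pieces_allowed U V H && boundary_is U V SW NW NE SE].

Definition Par (a c : nat) (SW NW NE SE : seq bool) : nat :=
  #|par_puzzles a c SW NW NE SE|.

(* Main.v *)
(* An auxiliary line of horizontal edges, with a spectral parameter z, can be moved
   by the Yang-Baxter equation from the left of the parallelogram, where it crosses
   the NW and SW sides, to its right, where it crosses the NE and SE sides. If the
   label 0 enters and leaves, the line does nothing to the strings on SW and NE and
   acts on those on NW and SE by the Pieri rule for multiplication by
   \prod_i (z + x_i); if the label 1 enters and leaves, the two pairs are exchanged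
   and it acts by the inverse of such an operator, up to a scalar. Hence Par is
   self-adjoint, in (alpha, beta) and in (gamma, delta), for the multiplication by
   every elementary symmetric polynomial. These generate the symmetric polynomials,
   so that
     Par(alpha, gamma, beta, delta) =
       \sum_(nu, kappa) c_(alpha, beta)^nu c_(gamma, delta)^kappa Par(1, 1, nu, kappa)
   where 1 stands for the identity strings 0..01..1. A puzzle with identity strings
   on the SW and NW sides is forced row by row. *)

Require Import Defs.
From mathcomp Require Import all_boot all_order all_algebra.
From mathcomp Require Import fingroup perm finmap mpoly ring zify.
From Stdlib Require Import ClassicalEpsilon.

Set Implicit Arguments.
Unset Strict Implicit.
Unset Printing Implicit Defensive.

Import GRing.Theory.

Local Open Scope ring_scope.

(** The parameter [z] of the auxiliary line is taken to be the indeterminate of [{poly int}]. Since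
    Par does not involve [z], coefficients can be compared, which isolates each elementary symmetric
    polynomial; and since [z] is nonzero in a domain, the scalar of the label-1 case can be
    cancelled. Inside the parallelogram all spectral parameters are 0, so that the equivariant piece
    occurs on the auxiliary line only. Symmetric polynomials enter through alternants. An elementary
    symmetric polynomial adds 0 or 1 to each exponent, and this matches the shifts of ones in a
    string, except that a string of length n only allows exponents below n. Hence Par is extended by
    0 to exponent lists that come from no string. Generation by the elementary polynomials takes the
    form of an induction on exponent lists that rewrites a product of two alternants and the
    matching value of Par by the same recursion. It also supplies the Schur expansion that [epsilon]
    must find. *)

Local Notation l0 := (Some false : label).
Local Notation l1 := (Some true : label).
Local Notation l10 := (None : label).

Local Notation simp :=
  (mulr0n, mulr1n, mul0r, mulr0, mul1r, mulr1, add0r, addr0, oppr0).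

(** * Weights and the Yang-Baxter equation *)

Lemma sum_label (V : nmodType) (F : label -> V) :
  \sum_(u : label) F u = F l0 + F l1 + F l10.
Proof.
rewrite (bigD1 l0) // (bigD1 l1) //= (bigD1 l10) //= big1 ?addr0 ?addrA //.
by case=> [[]|].
Qed.

(* The fillable unit rhombi, with edges read clockwise from the NW one; the label
   of the horizontal diagonal is determined by them. *)
Definition rhombus (nw ne se sw : label) : bool :=
  match nw, ne, se, sw with
  | Some false, Some false, Some false, Some false
  | Some false, Some false, None, Some true
  | None, Some true, Some false, Some false
  | None, Some true, None, Some true
  | Some true, Some true, Some true, Some true
  | Some true, Some true, Some false, None
  | Some false, None, Some true, Some true
  | Some false, None, Some false, None
  | Some true, Some false, Some true, Some false => true
  | _, _, _, _ => false
  end.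

(* The equivariant puzzle piece: the labels 0 and 1 cross each other. *)
Definition crossing (nw ne se sw : label) : bool :=
  match nw, ne, se, sw with
  | Some false, Some true, Some false, Some true => true
  | _, _, _, _ => false
  end.

(** At [z = 0] only the puzzle rhombi remain, so a vertex inside the parallelogram has weight 0 or
    1. *)
Definition wt (R : comPzRingType) (z : R) nw ne se sw : R :=
  (rhombus nw ne se sw)%:R + z * (crossing nw ne se sw)%:R.

Lemma rhombusE nw ne se sw :
  (rhombus nw ne se sw : nat) =
  (\sum_h (allowed_piece nw ne h && allowed_piece h se sw))%N.
Proof.
rewrite (bigD1 l0) // (bigD1 l1) //= (bigD1 l10) //= big1; last by case=> [[]|].
by case: nw => [[]|]; case: ne => [[]|]; case: se => [[]|]; case: sw => [[]|].
Qed.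

(** Big operators over [label] do not reduce; this explicit sum does so under [vm_compute]. *)
Definition label_count (p : label -> label -> label -> bool) : nat :=
  let sum F := (F l0 + F l1 + F l10)%N in
  sum (fun a => sum (fun b => sum (fun c => p a b c : nat))).

Lemma label_countE p : label_count p = (\sum_a \sum_b \sum_c p a b c)%N.
Proof. by rewrite /label_count !(@sum_label nat). Qed.

Definition all_labels (p : label -> bool) : bool := [&& p l0, p l1 & p l10].

Lemma all_labelsP (p : label -> bool) : all_labels p -> forall u, p u.
Proof. by case/and3P=> p0 p1 p10 [[]|]. Qed.

(** Separating the powers of [z] turns the Yang-Baxter equation over an arbitrary ring into
    identities between natural numbers. *)
Lemma sum3_wt (R : comPzRingType) (z : R)
    (r1 c1 r2 c2 r3 c3 : label -> label -> label -> bool) :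
  \sum_a \sum_b \sum_c
    ((r1 a b c)%:R + z * (c1 a b c)%:R) *
      (((r2 a b c)%:R + - z * (c2 a b c)%:R) *
        ((r3 a b c)%:R + 0 * (c3 a b c)%:R)) =
  (label_count (fun a b c => [&& r1 a b c, r2 a b c & r3 a b c]))%:R
  + z * ((label_count (fun a b c => [&& c1 a b c, r2 a b c & r3 a b c]))%:R
         - (label_count (fun a b c => [&& r1 a b c, c2 a b c & r3 a b c]))%:R)
  - z ^+ 2 *
      (label_count (fun a b c => [&& c1 a b c, c2 a b c & r3 a b c]))%:R.
Proof.
rewrite !label_countE.
rewrite !natr_sum -sumrB !mulr_sumr -!sumrN -!big_split /=.
apply: eq_bigr => a _.
rewrite !natr_sum -sumrB !mulr_sumr -!sumrN -!big_split /=.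
apply: eq_bigr => b _.
rewrite !natr_sum -sumrB !mulr_sumr -!sumrN -!big_split /=.
apply: eq_bigr => c _.
by case: (r1 a b c); case: (c1 a b c); case: (r2 a b c); case: (c2 a b c);
  case: (r3 a b c); case: (c3 a b c); rewrite /=; ring.
Qed.

(* Up to a rotation by 120 degrees, the first two factors are rhombi with two
   horizontal edges: an auxiliary line crosses the edges on the left, resp. right,
   of a puzzle rhombus. The identity is checked on all 3 ^ 6 boundaries. *)
Lemma yang_baxter (R : comPzRingType) (z : R) (hi x v u v' ho : label) :
  \sum_h \sum_x' \sum_v1
    wt z h x hi x' * (wt (- z) v1 ho v h * wt 0 x' v' u v1) =
  \sum_h \sum_y \sum_v1
    wt z ho y h u * (wt (- z) v' h v1 hi * wt 0 x v1 y v).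
Proof.
rewrite !sum3_wt.
set n0 := label_count _; set n1 := label_count _; set n2 := label_count _.
set n3 := label_count _; set m0 := label_count _; set m1 := label_count _.
set m2 := label_count _; set m3 := label_count _.
(* The coefficient of [z] is a difference of two counts; cross-adding keeps the test within the
   natural numbers. *)
suff /and3P[/eqP -> e12 /eqP ->] : [&& n0 == m0, n1 + m2 == m1 + n2 & n3 == m3]%N.
  congr (_ + _ * _ - _); apply/eqP.
  by rewrite subr_eq addrAC eq_sym subr_eq -!natrD eq_sym (eqP e12).
rewrite {}/n0 {}/n1 {}/n2 {}/n3 {}/m0 {}/m1 {}/m2 {}/m3.
move: ho; apply: all_labelsP; move: v'; apply: all_labelsP.
move: u; apply: all_labelsP; move: v; apply: all_labelsP.
move: x; apply: all_labelsP; move: hi; apply: all_labelsP.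
by vm_compute.
Qed.

Section Chains.
Variable R : comPzRingType.
Implicit Types (f : label -> label -> label -> label -> R) (F : seq label -> R).

(* Transfer matrix of a row of vertices with weight f, from the state x to the
   state y, applied to F as a function of the output word. *)
Fixpoint chain f (x y : label) F (w : seq label) : R :=
  if w is v :: w' then
    \sum_u \sum_v' f x v v' u * chain f u y (fun s => F (v' :: s)) w'
  else (x == y)%:R * F [::].

Lemma eq_chain f x y F G w : F =1 G -> chain f x y F w = chain f x y G w.
Proof.
elim: w x F G => [|v w IHw] x F G eqFG /=; first by rewrite eqFG.
by apply: eq_bigr => u _; apply: eq_bigr => v' _; congr (_ * _); apply: IHw.
Qed.

Lemma chain_sum (I : finType) f x y (c : I -> R) (G : I -> seq label -> R) w :
  chain f x y (fun s => \sum_i c i * G i s) w =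
  \sum_i c i * chain f x y (G i) w.
Proof.
elim: w x G => [|v w IHw] x G /=.
  by rewrite mulr_sumr; apply: eq_bigr => i _; rewrite mulrCA.
rewrite (eq_bigr _ (fun u _ => eq_bigr _ (fun v' _ => congr1 _ (IHw _ _)))).
under [RHS]eq_bigr => i _ do rewrite mulr_sumr.
rewrite [RHS]exchange_big; apply: eq_bigr => u _ /=.
under [RHS]eq_bigr => i _ do rewrite mulr_sumr.
rewrite [RHS]exchange_big; apply: eq_bigr => v' _ /=.
by rewrite mulr_sumr; apply: eq_bigr => i _; rewrite mulrCA.
Qed.

Lemma chain_sum2 (I J : finType) f x y (c : I -> J -> R)
    (G : I -> J -> seq label -> R) w :
  chain f x y (fun s => \sum_i \sum_j c i j * G i j s) w =
  \sum_i \sum_j c i j * chain f x y (G i j) w.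
Proof.
rewrite pair_bigA -(chain_sum _ _ _ (fun p => c p.1 p.2) (fun p => G p.1 p.2)).
by apply: eq_chain => s; rewrite pair_bigA.
Qed.

Lemma chainZ f x y (c : R) F w :
  chain f x y (fun s => c * F s) w = c * chain f x y F w.
Proof.
have := chain_sum f x y (fun _ : 'I_1 => c) (fun _ => F) w.
by rewrite big_ord1 => <-; apply: eq_chain => s; rewrite big_ord1.
Qed.

Lemma chain_comm f g x y x1 y1 (F : seq label -> seq label -> R) v w :
  chain f x y (fun s => chain g x1 y1 (F s) w) v =
  chain g x1 y1 (fun t => chain f x y (fun s => F s t) v) w.
Proof.
elim: v x F => [|a v IHv] x F /=; first by rewrite chainZ.
rewrite chain_sum2; apply: eq_bigr => u _; apply: eq_bigr => v' _.
by rewrite IHv.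
Qed.

(** * Moving an auxiliary line through a parallelogram *)

Definition row_wt (x v v' u : label) : R := wt 0 x v' u v.
Definition aux_wt (z : R) (h v v' h' : label) : R := wt (- z) v' h' v h.

(** The RTT relation: the Yang-Baxter equation, applied at one letter of [w] after the other, pulls
    the crossing of the two lines from the first end of the row to the last. *)
Lemma chain_exchange (z : R) hi ho x y F w :
  \sum_h \sum_x' wt z h x hi x' *
    chain (aux_wt z) h ho (chain row_wt x' y F) w =
  \sum_h \sum_y' wt z ho y' h y *
    chain row_wt x y' (chain (aux_wt z) hi h F) w.
Proof.
elim: w hi x F => [|v w IHw] hi x F /=.
  rewrite (bigD1 ho) //= (bigD1 y) //= [X in _ + X + _]big1 ?addr0 => [|u uy];
    last first.
    by rewrite (negPf uy) mul0r !mulr0.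
  rewrite [X in _ + X]big1 ?addr0 => [|u uy]; last first.
    by rewrite big1 // => t _; rewrite (negPf uy) mul0r !mulr0.
  rewrite [RHS](bigD1 hi) //= (bigD1 x) //= [X in _ + X + _]big1 ?addr0 => [|u uy];
    last first.
    by rewrite eq_sym (negPf uy) mul0r !mulr0.
  rewrite [X in _ + X]big1 ?addr0 => [|u uy]; last first.
    by rewrite big1 // => t _; rewrite [hi == u]eq_sym (negPf uy) mul0r !mulr0.
  by rewrite !eqxx.
(* [C] collects what lies beyond the first letter and is not touched by the Yang-Baxter equation
   there. *)
pose C h' u v' := chain (aux_wt z) h' ho (chain row_wt u y (fun s => F (v' :: s))) w.
transitivity (\sum_v' \sum_h' \sum_u (\sum_h \sum_x' \sum_v1
    wt z h x hi x' * (wt (- z) v1 h' v h * wt 0 x' v' u v1)) * C h' u v').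
  transitivity (\sum_h \sum_x' \sum_h' \sum_v1 \sum_u \sum_v'
      wt z h x hi x' * (wt (- z) v1 h' v h * wt 0 x' v' u v1) * C h' u v').
    apply: eq_bigr => h _; apply: eq_bigr => x' _.
    rewrite mulr_sumr; apply: eq_bigr => h' _.
    rewrite mulr_sumr; apply: eq_bigr => v1 _.
    rewrite chain_sum2 mulrA mulr_sumr; apply: eq_bigr => u _.
    by rewrite mulr_sumr; apply: eq_bigr => v' _; rewrite !mulrA.
  under [RHS]eq_bigr => v' _ do (under eq_bigr => h' _ do (under eq_bigr => u _ do
    (rewrite mulr_suml; under eq_bigr => h _ do
      (rewrite mulr_suml; under eq_bigr => x' _ do rewrite mulr_suml)))).
  rewrite !pair_bigA /=.
  rewrite (reindex (fun q : label * label * label * label * label * label =>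
    let: (v', h', u, h, x', v1) := q in (h, x', h', v1, u, v'))).
    by apply: eq_bigr => -[[[[[? ?] ?] ?] ?] ?] _.
  by exists (fun q => let: (h, x', h', v1, u, v') := q in (v', h', u, h, x', v1));
    case=> [[[[[? ?] ?] ?] ?] ?].
transitivity (\sum_v' \sum_h' \sum_u (\sum_h \sum_y1 \sum_v1
    wt z h' y1 h u * (wt (- z) v' h v1 hi * wt 0 x v1 y1 v)) * C h' u v').
  apply: eq_bigr => v' _; apply: eq_bigr => h' _; apply: eq_bigr => u _.
  by congr (_ * _); exact: yang_baxter.
transitivity (\sum_v' \sum_h \sum_y1 \sum_v1
    (wt (- z) v' h v1 hi * wt 0 x v1 y1 v) *
    (\sum_h' \sum_u wt z h' y1 h u * C h' u v')).
  under eq_bigr => v' _ do (under eq_bigr => h' _ do (under eq_bigr => u _ do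
    (rewrite mulr_suml; under eq_bigr => h _ do
      (rewrite mulr_suml; under eq_bigr => x' _ do rewrite mulr_suml)))).
  under [RHS]eq_bigr => v' _ do (under eq_bigr => h _ do (under eq_bigr => y1 _ do
    (under eq_bigr => v1 _ do (rewrite mulr_sumr;
      under eq_bigr => h' _ do rewrite mulr_sumr)))).
  apply: eq_bigr => v' _; rewrite !pair_bigA /=.
  rewrite (reindex (fun q : label * label * label * label * label =>
    let: (h, y1, v1, h', u) := q in (h', u, h, y1, v1))).
    by apply: eq_bigr => -[[[[? ?] ?] ?] ?] _ /=; rewrite !mulrA; congr (_ * _); ring.
  by exists (fun q => let: (h', u, h, y1, v1) := q in (h, y1, v1, h', u));
    case=> [[[[? ?] ?] ?] ?].
transitivity (\sum_v' \sum_h \sum_y1 \sum_v1 \sum_h2 \sum_y2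
    (wt (- z) v' h v1 hi * wt 0 x v1 y1 v) * (wt z ho y2 h2 y *
     chain row_wt y1 y2 (chain (aux_wt z) h h2 (fun s => F (v' :: s))) w)).
  apply: eq_bigr => v' _; apply: eq_bigr => h _; apply: eq_bigr => y1 _.
  apply: eq_bigr => v1 _; rewrite /C IHw mulr_sumr; apply: eq_bigr => h2 _.
  by rewrite mulr_sumr.
transitivity (\sum_h2 \sum_y2 \sum_y1 \sum_v1 \sum_h \sum_v'
   wt z ho y2 h2 y * (wt 0 x v1 y1 v * (wt (- z) v' h v1 hi *
     chain row_wt y1 y2 (chain (aux_wt z) h h2 (fun s => F (v' :: s))) w))).
  rewrite !pair_bigA /=.
  rewrite (reindex (fun q : label * label * label * label * label * label =>
    let: (h2, y2, y1, v1, h, v') := q in (v', h, y1, v1, h2, y2))).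
    by apply: eq_bigr => -[[[[[? ?] ?] ?] ?] ?] _ /=; ring.
  by exists (fun q => let: (v', h, y1, v1, h2, y2) := q in (h2, y2, y1, v1, h, v'));
    case=> [[[[[? ?] ?] ?] ?] ?].
apply: eq_bigr => h2 _; apply: eq_bigr => y2 _.
rewrite mulr_sumr; apply: eq_bigr => y1 _.
rewrite mulr_sumr; apply: eq_bigr => v1 _.
rewrite chain_sum2 mulrA mulr_sumr; apply: eq_bigr => h _.
by rewrite mulr_sumr; apply: eq_bigr => v' _; rewrite -!mulrA.
Qed.

Fixpoint stack (xs ys : seq label) F w : R :=
  match xs, ys with
  | x :: xs', y :: ys' => chain row_wt x y (stack xs' ys' F) w
  | [::], [::] => F w
  | _, _ => 0
  end.

(* An auxiliary line running down along the NW side (left_wt, outer label x, inner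
   label x') or the SE side (right_wt, outer label y); h is the auxiliary label
   below the crossed edge, h' the one above it. *)
Definition left_wt (z : R) (h x x' h' : label) : R := wt z h x h' x'.
Definition right_wt (z : R) (h y y' h' : label) : R := wt z h y' h' y.

(** [chain_exchange] lifts the line over the first row; [chain_comm] then moves the crossings with
    the other rows into and out of that row, since they concern different words. *)
Lemma train (z : R) hi ho xs ys F w : size xs = size ys ->
  \sum_h chain (left_wt z) h hi
    (fun xs' => chain (aux_wt z) h ho (stack xs' ys F) w) xs =
  \sum_h chain (right_wt z) ho h
    (fun ys' => stack xs ys' (chain (aux_wt z) hi h F) w) ys.
Proof.
elim: xs ys ho w => [|x xs IHxs] [|y ys] // ho w => [_|[sz_xs]] /=.
  rewrite (bigD1 hi) //= big1 => [|h neq]; last by rewrite (negPf neq) mul0r.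
  rewrite [RHS](bigD1 ho) //= [X in _ = _ + X]big1 => [|h neq]; last first.
    by rewrite eq_sym (negPf neq) mul0r.
  by rewrite !eqxx.
transitivity (\sum_h1 \sum_h \sum_y' wt z ho y' h y *
  chain row_wt x y' (fun t => chain (left_wt z) h1 hi (fun xs' =>
    chain (aux_wt z) h1 h (stack xs' ys F) t) xs) w).
  rewrite exchange_big; apply: eq_bigr => h1 _ /=.
  rewrite -(chain_sum2 _ _ _ (fun h x' => wt z h x h1 x') (fun h x' xs' =>
    chain (aux_wt z) h ho (chain row_wt x' y (stack xs' ys F)) w)).
  rewrite (eq_chain _ _ _ _ (fun xs' => chain_exchange z h1 ho x y (stack xs' ys F) w)).
  rewrite chain_sum2; apply: eq_bigr => h _; apply: eq_bigr => y' _.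
  by rewrite (chain_comm _ _ _ _ _ _ (fun xs' t => chain (aux_wt z) h1 h (stack xs' ys
    F) t)).
rewrite exchange_big [RHS]exchange_big; apply: eq_bigr => h _ /=.
rewrite exchange_big [RHS]exchange_big; apply: eq_bigr => y' _ /=.
rewrite -mulr_sumr -[RHS]mulr_sumr; congr (_ * _).
transitivity (chain row_wt x y' (fun t => \sum_h1 1 * chain (left_wt z) h1 hi
  (fun xs' => chain (aux_wt z) h1 h (stack xs' ys F) t) xs) w).
  by rewrite chain_sum; apply: eq_bigr => h1 _; rewrite mul1r.
transitivity (chain row_wt x y' (fun t => \sum_h2 1 * chain (right_wt z) h h2
  (fun ys' => stack xs ys' (chain (aux_wt z) hi h2 F) t) ys) w).
  apply: eq_chain => t; rewrite (eq_bigr _ (fun h1 _ => mul1r _)) IHxs //.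
  by apply: eq_bigr => h2 _; rewrite mul1r.
rewrite chain_sum; apply: eq_bigr => h2 _; rewrite mul1r.
by rewrite (chain_comm _ _ _ _ _ _ (fun ys' t => stack xs ys' (chain (aux_wt z) hi h2
  F) t)).
Qed.

End Chains.

Lemma big_tuple0 (V : nmodType) (T : finType) (F : seq T -> V) :
  \sum_(s : 0.-tuple T) F s = F [::].
Proof.
rewrite (eq_bigr (fun _ => F [::])) => [|s _]; last by rewrite tuple0.
by rewrite sumr_const card_tuple expn0.
Qed.

Lemma big_tupleS (V : nmodType) (T : finType) n (F : seq T -> V) :
  \sum_(s : n.+1.-tuple T) F s = \sum_x \sum_(s : n.-tuple T) F (x :: s).
Proof.
rewrite pair_bigA /=.
rewrite (reindex (fun p : T * n.-tuple T => [tuple of p.1 :: p.2])) //=.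
exists (fun s : n.+1.-tuple T => (thead s, [tuple of behead s])) => [[x s] _|s _].
  by congr (_, _); apply/val_inj.
by rewrite -tuple_eta.
Qed.

Lemma sum_bool (V : nmodType) (F : bool -> V) : \sum_b F b = F true + F false.
Proof. by rewrite (bigD1 true) // (bigD1 false) //= big1 ?addr0 //; case. Qed.

Lemma count_negb s : count negb s = (size s - count id s)%N.
Proof. by rewrite -(count_predC id s) addKn. Qed.

(** * The auxiliary line acts on binary strings by the Pieri rule *)

Section Pieri.
Variable R : comPzRingType.
Implicit Types (F G : seq label -> R) (z : R).

Definition pieri_wt z (c v v' : bool) : R :=
  if c then v'%:R else if v then (if v' then z else 1) else (~~ v')%:R.

Definition pieri_next (c v v' : bool) : bool := v && (c || ~~ v').

(* Transfer matrix moving ones to the right by at most one place each; the flag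
   tells whether a one is being carried over from the previous place, and z
   counts the ones that stay. *)
Fixpoint pieri z (c : bool) (s t : seq bool) : R :=
  match s, t with
  | [::], [::] => (~~ c)%:R
  | v :: s', v' :: t' => pieri_wt z c v v' * pieri z (pieri_next c v v') s' t'
  | _, _ => 0
  end.

Definition labels (s : seq bool) : seq label := map Some s.
Definition dirac (t s : seq label) : R := (s == t)%:R.
(** On an auxiliary line that leaves with 0, the label 10 is a one in transit to the next place. *)
Definition carry (c : bool) : label := if c then l10 else l0.

Lemma sum_pieri_outS z c x n (xs : seq bool) (G : seq bool -> R) :
  \sum_(s : n.+1.-tuple bool) pieri z c s (x :: xs) * G s =
  \sum_b pieri_wt z c b x *
    \sum_(s : n.-tuple bool) pieri z (pieri_next c b x) s xs * G (b :: s).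
Proof.
rewrite (big_tupleS _ (fun s => pieri z c s (x :: xs) * G s)).
by apply: eq_bigr => b _; rewrite mulr_sumr; apply: eq_bigr => s _; rewrite mulrA.
Qed.

Lemma sum_pieri_inS z c x n (xs : seq bool) (G : seq bool -> R) :
  \sum_(s : n.+1.-tuple bool) pieri z c (x :: xs) s * G s =
  \sum_b pieri_wt z c x b *
    \sum_(s : n.-tuple bool) pieri z (pieri_next c x b) xs s * G (b :: s).
Proof.
rewrite (big_tupleS _ (fun s => pieri z c (x :: xs) s * G s)).
by apply: eq_bigr => b _; rewrite mulr_sumr; apply: eq_bigr => s _; rewrite mulrA.
Qed.

Lemma chain_left0 z c G xs :
  chain (left_wt z) (carry c) l0 G (labels xs) =
  \sum_(s : (size xs).-tuple bool) pieri z c s xs * G (labels s).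
Proof.
elim: xs c G => [|x xs IH] c G /=.
  by rewrite (big_tuple0 (fun s => pieri z c s [::] * G (labels s))) /=; case: c.
rewrite (sum_pieri_outS z c x _ xs (G \o labels)) sum_bool /=.
rewrite -(IH _ (fun s => G (Some true :: s))) -(IH _ (fun s => G (Some false :: s))).
by rewrite !sum_label; case: c x => [] []; rewrite /left_wt /wt /= !simp // addrC.
Qed.

(** Next to a binary side label, a vertex with 1 on the line below it has 1 above it too. *)
Lemma chain_right_dead z G ys : chain (right_wt z) l1 l0 G (labels ys) = 0.
Proof.
elim: ys G => [|y ys IH] G /=; first by rewrite mul0r.
by rewrite !sum_label !IH; case: y; rewrite /right_wt /wt /= !simp.
Qed.

Lemma chain_right0 z c G ys :
  chain (right_wt z) (carry c) l0 G (labels ys) =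
  \sum_(s : (size ys).-tuple bool) pieri z c ys s * G (labels s).
Proof.
elim: ys c G => [|y ys IH] c G /=.
  by rewrite (big_tuple0 (fun s => pieri z c [::] s * G (labels s))) /=; case: c.
rewrite (sum_pieri_inS z c y _ ys (G \o labels)) sum_bool /=.
rewrite -(IH _ (fun s => G (Some true :: s))) -(IH _ (fun s => G (Some false :: s))).
by rewrite !sum_label !chain_right_dead; case: c y => [] [];
  rewrite /right_wt /wt /= !simp // addrC.
Qed.

Lemma chain_aux0_dead z h F w : h != l0 ->
  chain (aux_wt z) h l0 F (labels w) = 0.
Proof.
elim: w h F => [|v w IH] h F /=; first by move/negPf=> ->; rewrite mul0r.
rewrite !sum_label !(IH l1) // !(IH l10) //.
by case: h v => [[]|] [] // _; rewrite /aux_wt /wt /= !simp.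
Qed.

Lemma chain_aux0 z h F w :
  chain (aux_wt z) h l0 F (labels w) = (h == l0)%:R * F (labels w).
Proof.
have [->|h0] := eqVneq h l0; last by rewrite chain_aux0_dead // mul0r.
rewrite mul1r; elim: w F => [|v w IH] F /=; first by rewrite mul1r.
rewrite !sum_label !(chain_aux0_dead _ (h := l1)) // !(chain_aux0_dead _ (h := l10)) //.
rewrite !(IH (fun s => F (_ :: s))).
by case: v; rewrite /aux_wt /wt /= !simp.
Qed.

Lemma chain0 (f : label -> label -> label -> label -> R) x y w :
  chain f x y (fun=> 0) w = 0.
Proof.
elim: w x => [|v w IH] x /=; first by rewrite mulr0.
by rewrite big1 // => u _; rewrite big1 // => v' _; rewrite IH mulr0.
Qed.

Lemma delta_cons a t v : (fun s => dirac (a :: t) (v :: s)) =1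
  (fun s => (v == a)%:R * dirac t s).
Proof. by move=> s; rewrite /dirac eqseq_cons; case: (v == a);
  rewrite ?mul1r ?mul0r. Qed.

Lemma chain_cons_delta (f : label -> label -> label -> label -> R) x y a t v w :
  chain f x y (fun s => dirac (a :: t) (v :: s)) w =
  (v == a)%:R * chain f x y (dirac t) w.
Proof. by rewrite (eq_chain _ _ _ _ (delta_cons _ _ _)) chainZ. Qed.

Lemma chain_delta_cons (f : label -> label -> label -> label -> R) x y a t v w :
  chain f x y (dirac (a :: t)) (v :: w) =
  \sum_u f x v a u * chain f u y (dirac t) w.
Proof.
rewrite /=; apply: eq_bigr => u _; rewrite (bigD1 a) //= big1 => [|v' /negPf va].
  by rewrite addr0 chain_cons_delta eqxx mul1r.
by rewrite chain_cons_delta va mul0r mulr0.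
Qed.

Lemma chain_delta_size (f : label -> label -> label -> label -> R) x y t w :
  size w != size t -> chain f x y (dirac t) w = 0.
Proof.
elim: w t x => [|v w IH] [|a t] x //= neq.
- by rewrite mulr0.
- by rewrite big1 // => u _; rewrite big1 // => v' _; rewrite chain0 mulr0.
by rewrite big1 // => u _; rewrite big1 // => v' _;
  rewrite chain_cons_delta IH // !mulr0.
Qed.

(** Unlike in [chain_aux0], the incoming word comes out of the rows and could contain 10. It is the
    binary target word that forces the line to act trivially. *)
Lemma chain_aux0_delta z h t w :
  chain (aux_wt z) l0 h (dirac (labels t)) w = (h == l0)%:R * dirac (labels t) w.
Proof.
have [sz|sz] := eqVneq (size w) (size (labels t)); last first.
  rewrite chain_delta_size // /dirac (_ : (w == _) = false) ?mulr0 //.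
  by apply: contra_neqF sz => /eqP->.
elim: w t sz => [|v w IH] [|a t] //= sz; first by rewrite eq_sym.
rewrite -/(chain _ _ _ _ (v :: w)) chain_delta_cons -/(labels t) delta_cons.
case: sz => sz; rewrite sum_label IH //.
by case: a v => [] [[]|]; rewrite /aux_wt /wt /= !simp.
Qed.

Lemma chain_left1_dead z c G xs : chain (left_wt z) (carry c) l1 G (labels xs) = 0.
Proof.
elim: xs c G => [|x xs IH] c G /=; first by case: c; rewrite mul0r.
rewrite !sum_label !(IH false) !(IH true).
by case: c x => [] []; rewrite /left_wt /wt /= !simp.
Qed.

Lemma chain_left1 z h G xs :
  chain (left_wt z) h l1 G (labels xs) = (h == l1)%:R * G (labels xs).
Proof.
case: h => [[]|]; rewrite ?(chain_left1_dead z false) ?(chain_left1_dead z true) ?mul0r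
  //.
rewrite mul1r; elim: xs G => [|x xs IH] G /=; first by rewrite mul1r.
rewrite !sum_label !(chain_left1_dead z false) !(chain_left1_dead z true).
rewrite !(IH (fun s => G (_ :: s))).
by case: x; rewrite /left_wt /wt /= !simp.
Qed.

Lemma chain_right1 z h G ys :
  chain (right_wt z) l1 h G (labels ys) = (h == l1)%:R * G (labels ys).
Proof.
elim: ys G => [|y ys IH] G /=; first by rewrite eq_sym.
rewrite !sum_label !(IH (fun s => G (_ :: s))).
by case: y; rewrite /right_wt /wt /= !simp.
Qed.

(** For a line that leaves with 1 the roles of 0 and 1 are exchanged: 10 is a zero in transit. *)
Definition aux_carry (c : bool) : label := if c then l10 else l1.

Lemma chain_aux1 z c F w :
  chain (aux_wt z) (aux_carry c) l1 F (labels w) =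
  \sum_(s : (size w).-tuple bool)
    pieri (- z) c (map negb s) (map negb w) * F (labels s).
Proof.
elim: w c F => [|v w IH] c F /=.
  by rewrite (big_tuple0 (fun s => pieri _ c (map negb s) [::] * F (labels s))) /=;
    case: c.
rewrite (big_tupleS _ (fun s => pieri _ c (map negb s) _ * F (labels s))) sum_bool /=.
have IH' b c' k : \sum_(s : (size w).-tuple bool)
    k * pieri (- z) c' (map negb s) (map negb w) * F (Some b :: labels s) =
    k * chain (aux_wt z) (aux_carry c') l1 (fun s => F (Some b :: s)) (labels w).
  by rewrite IH mulr_sumr; apply: eq_bigr => s _; rewrite mulrA.
rewrite !IH' !sum_label; case: c v => [] [];
  by rewrite /aux_wt /wt /= !simp // addrC.
Qed.

Lemma chain_aux1_delta z c t w :
  chain (aux_wt z) (aux_carry c) l1 (dirac (labels t)) w =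
  \sum_(s : (size t).-tuple bool)
    pieri (- z) c (map negb t) (map negb s) * dirac (labels s) w.
Proof.
have [sz|sz] := eqVneq (size w) (size t); last first.
  rewrite chain_delta_size ?size_map // big1 // => s _.
  rewrite /dirac (_ : (w == _) = false) ?mulr0 //.
  by apply: contra_neqF sz => /eqP->; rewrite size_map size_tuple.
elim: w t sz c => [|v w IH] [|a t] // sz c.
  rewrite (big_tuple0 (fun s => pieri _ c [::] (map negb s) * dirac (labels s) [::])).
  by rewrite /dirac; case: c.
rewrite [labels _]/= chain_delta_cons -/(labels t).
rewrite (big_tupleS _ (fun s => pieri _ c (_ :: _) (map negb s) * dirac (labels s) _)).
case: sz => sz; rewrite sum_bool /=.
have IH' b c' k : \sum_(s : (size t).-tuple bool)
    k * pieri (- z) c' (map negb t) (map negb s) * dirac (Some b :: labels s) (v :: w) =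
    (v == Some b)%:R * k * chain (aux_wt z) (aux_carry c') l1 (dirac (labels t)) w.
  rewrite IH // mulr_sumr; apply: eq_bigr => s _; rewrite delta_cons; ring.
rewrite !IH' !sum_label (chain_aux0_delta _ l1) !simp.
by case: c a v IH' => [] [] [[]|] _; rewrite /aux_wt /wt /= !simp // addrC.
Qed.

Lemma eq_stack xs ys F G w : F =1 G -> stack xs ys F w = stack xs ys G w.
Proof.
move=> eqFG; elim: xs ys w => [|x xs IH] [|y ys] w //=; apply: eq_chain => s.
exact: IH.
Qed.

Lemma stack_sum (I : finType) xs ys (c : I -> R) (G : I -> seq label -> R) w :
  stack xs ys (fun s => \sum_i c i * G i s) w =
  \sum_i c i * stack xs ys (G i) w.
Proof.
elim: xs ys w => [|x xs IH] [|y ys] w //=.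
- by rewrite big1 // => i _; rewrite mulr0.
- by rewrite big1 // => i _; rewrite mulr0.
by rewrite (eq_chain _ _ _ _ (IH ys)) chain_sum.
Qed.

(** The arguments are the NW, SE, SW and NE sides, all read along the coordinates; SE and SW are
    therefore reversed with respect to the clockwise reading. *)
Definition puzzle_sum (xs ys w w' : seq bool) : R :=
  stack (labels xs) (labels ys) (dirac (labels w')) (labels w).

Lemma puzzle_sum_pieri_side z xs ys w w' : size xs = size ys ->
  \sum_(s : (size xs).-tuple bool) pieri z false s xs * puzzle_sum s ys w w' =
  \sum_(s : (size ys).-tuple bool) pieri z false ys s * puzzle_sum xs s w w'.
Proof.
move=> sz; have := train z l0 l0 (dirac (labels w')) (labels w) (xs := labels xs)
  (ys := labels ys).
rewrite !size_map => /(_ sz).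
rewrite (eq_bigr (fun h => (h == l0)%:R * chain (left_wt z) h l0 (fun xs' =>
  stack xs' (labels ys) (dirac (labels w')) (labels w)) (labels xs))); last first.
  move=> h _; rewrite -chainZ; apply: eq_chain => s; exact: chain_aux0.
rewrite [RHS](eq_bigr (fun h => (h == l0)%:R * chain (right_wt z) l0 h (fun ys' =>
  stack (labels xs) ys' (dirac (labels w')) (labels w)) (labels ys))); last first.
  move=> h _; rewrite -chainZ; apply: eq_chain => s.
  rewrite (eq_stack _ _ _ (chain_aux0_delta z h w')).
  have := stack_sum (labels xs) s (fun _ : 'I_1 => (h == l0)%:R)
    (fun _ => dirac (labels w')) (labels w).
  by rewrite big_ord1 => <-; apply: eq_stack => t; rewrite big_ord1.
rewrite !sum_label /= !mul0r !addr0 !mul1r.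
by rewrite (chain_left0 z false) (chain_right0 z false).
Qed.

Lemma puzzle_sum_pieri_base z xs ys w w' : size xs = size ys ->
  \sum_(s : (size w).-tuple bool)
    pieri (- z) false (map negb s) (map negb w) * puzzle_sum xs ys s w' =
  \sum_(s : (size w').-tuple bool)
    pieri (- z) false (map negb w') (map negb s) * puzzle_sum xs ys w s.
Proof.
move=> sz; have := train z l1 l1 (dirac (labels w')) (labels w) (xs := labels xs)
  (ys := labels ys).
rewrite !size_map => /(_ sz).
rewrite (eq_bigr (fun h => (h == l1)%:R * 
  chain (aux_wt z) h l1 (stack (labels xs) (labels ys) (dirac (labels w'))) (labels
    w)));
  last by move=> h _; rewrite chain_left1.
rewrite [RHS](eq_bigr (fun h => (h == l1)%:R * stack (labels xs) (labels ys)
   (chain (aux_wt z) l1 h (dirac (labels w'))) (labels w)));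
  last by move=> h _; rewrite chain_right1.
rewrite !sum_label /= !mul0r !addr0 !add0r !mul1r.
rewrite (chain_aux1 z false) => ->.
by rewrite (eq_stack _ _ _ (chain_aux1_delta z false w')) stack_sum.
Qed.

End Pieri.

(** * Inverting the operator of the label 1 *)

Section PieriInverse.
Variables (R : comPzRingType) (z : R).

Definition pieri_unit (w : seq bool) : R :=
  (- z) ^+ count negb w * z ^+ count id w.

Let D p q w t := \sum_(s : (size w).-tuple bool)
  pieri z p w s * pieri (- z) q (map negb t) (map negb s).

Let D_cons p q v w x t :
  D p q (v :: w) (x :: t) = \sum_b pieri_wt z p v b *
     pieri_wt (- z) q (~~ x) (~~ b) *
       D (pieri_next p v b) (pieri_next q (~~ x) (~~ b)) w t.
Proof.
rewrite /D (big_tupleS _ (fun s => pieri z p (v :: w) s * pieri (- z) q (map negb (x ::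
  t)) (map negb s))).
apply: eq_bigr => b _; rewrite mulr_sumr; apply: eq_bigr => s _ /=; ring.
Qed.

(** If [w] starts with a one and [t] with a zero, the middle letter is free; the two choices have
    weights [z] and [- z] and differ in which operator carries. The second clause makes them
    cancel. *)
Let D_spec w t : size w = size t ->
  D false false w t = (w == t)%:R * pieri_unit w /\
  D true false w t = D false true w t.
Proof.
elim: w t => [|v w IH] [|x t] //.
  rewrite /D !(big_tuple0 (fun s => pieri _ _ [::] s * pieri _ _ _ (map negb s))).
  by rewrite /= /pieri_unit /= !simp.
case=> /IH[D0 D1]; split; rewrite !D_cons !sum_bool; last first.
  by case: v x => [] [] /=; rewrite !simp.
rewrite eqseq_cons /pieri_unit /=.
case: v x => [] [] /=; rewrite !simp ?D0 ?D1 /pieri_unit ?add1n ?add0n ?exprS; ring.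
Qed.

Let S p q w t := \sum_(s : (size w).-tuple bool)
  pieri (- z) q (map negb s) (map negb w) * pieri z p s t.

Let S_cons p q v w x t :
  S p q (v :: w) (x :: t) = \sum_b pieri_wt z p b x *
     pieri_wt (- z) q (~~ b) (~~ v) *
       S (pieri_next p b x) (pieri_next q (~~ b) (~~ v)) w t.
Proof.
rewrite /S (big_tupleS _ (fun s => pieri (- z) q (map negb s) (map negb (v :: w)) *
  pieri z p s (x :: t))).
apply: eq_bigr => b _; rewrite mulr_sumr; apply: eq_bigr => s _ /=; ring.
Qed.

(** Here the two choices of the middle letter both have weight 1, so the sign sits in the exchange
    of the carries. *)
Let S_spec w t : size w = size t ->
  S false false w t = (w == t)%:R * pieri_unit w /\
  S true false w t = - S false true w t.
Proof.
elim: w t => [|v w IH] [|x t] //.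
  rewrite /S !(big_tuple0 (fun s => pieri _ _ (map negb s) _ * pieri _ _ s _)).
  by rewrite /= /pieri_unit /= !simp.
case=> /IH[D0 D1]; split; rewrite !S_cons !sum_bool.
  rewrite eqseq_cons /pieri_unit /=.
  by case: v x => [] [] /=; rewrite !simp ?D0 ?D1 /pieri_unit ?add1n ?add0n ?exprS;
    ring.
by case: v x => [] [] /=; rewrite !simp ?D0 ?D1; ring.
Qed.

(** The string form of E(t) H(-t) = 1 for elementary and complete symmetric polynomials: shifts of
    ones are vertical strips, shifts of zeros are horizontal strips. *)
Lemma pieri_complement w t : size w = size t ->
  \sum_(s : (size w).-tuple bool)
    pieri z false w s * pieri (- z) false (map negb t) (map negb s) =
  (w == t)%:R * pieri_unit w.
Proof. by case/D_spec. Qed.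

Lemma complement_pieri w t : size w = size t ->
  \sum_(s : (size w).-tuple bool)
    pieri (- z) false (map negb s) (map negb w) * pieri z false s t =
  (w == t)%:R * pieri_unit w.
Proof. by case/S_spec. Qed.

End PieriInverse.

(** The label-1 line shows that P commutes with H, while E H and H E are the scalar c of
    [pieri_unit]. Hence c E P = E P H E = E H P E = c P E, and c is cancelled. *)
Lemma puzzle_sum_pieri (R : idomainType) (z : R) xs ys w w' :
  z != 0 -> size xs = size ys -> size w = size w' -> count id w = count id w' ->
  \sum_(s : (size w).-tuple bool) pieri z false w s * puzzle_sum R xs ys s w' =
  \sum_(s : (size w).-tuple bool) puzzle_sum R xs ys w s * pieri z false s w'.
Proof.
move=> z0 sz_xs sz_w cnt_w.
(* H E produces the scalar of [w'] and E H that of [w]; they agree because it depends only on the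
   numbers of zeros and ones. *)
have unit_w' : pieri_unit z w' = pieri_unit z w.
  by rewrite /pieri_unit !count_negb sz_w cnt_w.
have unit0 : pieri_unit z w != 0.
  by rewrite /pieri_unit mulf_neq0 // expf_neq0 // oppr_eq0.
apply: (mulfI unit0).
set n := size w; set E := pieri z false; set P := puzzle_sum R xs ys.
pose H (s t : seq bool) := pieri (- z) false (map negb t) (map negb s).
have EH (s : n.-tuple bool) : \sum_(t : n.-tuple bool) E w t * H t s =
    (w == s)%:R * pieri_unit z w.
  by apply: pieri_complement; rewrite size_tuple.
have HE (s : n.-tuple bool) : \sum_(t : n.-tuple bool) H s t * E t w' =
    (val s == w')%:R * pieri_unit z s.
  have := @complement_pieri R z s w'; rewrite !size_tuple => -> //.
have HP (s t : n.-tuple bool) : \sum_(u : n.-tuple bool) H s u * P u t =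
    \sum_(u : n.-tuple bool) P s u * H u t.
  have := puzzle_sum_pieri_base z s t sz_xs; rewrite !size_tuple => ->.
  by apply: eq_bigr => u _; rewrite mulrC.
transitivity (\sum_(t : n.-tuple bool) \sum_(s : n.-tuple bool)
    E w t * (\sum_(u : n.-tuple bool) P t u * H u s) * E s w').
  rewrite mulr_sumr; apply: eq_bigr => t _.
  transitivity (E w t * \sum_(u : n.-tuple bool) P t u *
     \sum_(s : n.-tuple bool) H u s * E s w').
    under eq_bigr => u _ do rewrite HE.
    rewrite mulrCA; congr (_ * _).
    have szw' : size w' == n by rewrite -sz_w.
    rewrite (bigD1 (Tuple szw')) //= eqxx big1 => [|u].
      by rewrite mul1r addr0 unit_w' mulrC.
    by rewrite -val_eqE /= => /negPf ->; rewrite mul0r mulr0.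
  under [RHS]eq_bigr => s _ do rewrite mulr_sumr mulr_suml.
  rewrite mulr_sumr [RHS]exchange_big; apply: eq_bigr => u _ /=.
  by rewrite !mulr_sumr; apply: eq_bigr => s _; rewrite !mulrA.
transitivity (\sum_(s : n.-tuple bool) \sum_(u : n.-tuple bool)
    (\sum_(t : n.-tuple bool) E w t * H t u) * (P u s * E s w')).
  rewrite exchange_big; apply: eq_bigr => s _ /=.
  under [RHS]eq_bigr => u _ do rewrite mulr_suml.
  rewrite [RHS]exchange_big; apply: eq_bigr => t _ /=.
  rewrite -HP mulr_sumr mulr_suml; apply: eq_bigr => u _.
  by rewrite !mulrA.
rewrite mulr_sumr; apply: eq_bigr => s _.
under eq_bigr => u _ do rewrite EH.
rewrite (bigD1 (in_tuple w)) //= eqxx big1 => [|u].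
  by rewrite addr0 mul1r.
by rewrite -val_eqE eq_sym /= => /negPf ->; rewrite !mul0r.
Qed.

(** * Par as an iterated transfer matrix *)

Lemma forall_ordS n (P : pred nat) :
  [forall i : 'I_n.+1, P i] = P 0%N && [forall i : 'I_n, P i.+1].
Proof.
apply/forallP/andP => [h|[h0 /forallP h] [[|i] lt_i]] //.
  by split; [exact: (h ord0)|apply/forallP => i; exact: (h (lift ord0 i))].
exact: (h (Ordinal (lt_i : (i < n)%N))).
Qed.

Definition row_ok (u v v' h : seq label) : bool :=
  [forall j : 'I_(size v),
    allowed_piece (nth l0 u j) (nth l0 v' j) (nth l0 h j) &&
    allowed_piece (nth l0 h j) (nth l0 u j.+1) (nth l0 v j)].

Lemma row_okE n u v v' h : size v = n -> row_ok u v v' h =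
  [forall j : 'I_n,
    allowed_piece (nth l0 u j) (nth l0 v' j) (nth l0 h j) &&
    allowed_piece (nth l0 h j) (nth l0 u j.+1) (nth l0 v j)].
Proof. by move=> <-. Qed.

Lemma row_ok_cons u0 u v0 v v0' v' h0 h :
  row_ok (u0 :: u) (v0 :: v) (v0' :: v') (h0 :: h) =
  (allowed_piece u0 v0' h0 && allowed_piece h0 (head l0 u) v0) &&
  row_ok u v v' h.
Proof.
rewrite /row_ok (forall_ordS _ (fun j =>
  allowed_piece (nth l0 (u0 :: u) j) (nth l0 (v0' :: v') j) (nth l0 (h0 :: h) j) &&
  allowed_piece (nth l0 (h0 :: h) j) (nth l0 (u0 :: u) j.+1) (nth l0 (v0 :: v) j))).
by rewrite /= nth0.
Qed.

Fixpoint rows_ok (us : seq (seq label)) (v : seq label)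
    (vs hs : seq (seq label)) : bool :=
  match us, vs, hs with
  | u :: us', v' :: vs', h :: hs' => row_ok u v v' h && rows_ok us' v' vs' hs'
  | _, _, _ => true
  end.

Lemma rows_okE n us v vs hs : size us = n -> size vs = n -> size hs = n ->
  rows_ok us v vs hs =
  [forall i : 'I_n,
    row_ok (nth [::] us i) (nth [::] (v :: vs) i) (nth [::] vs i) (nth [::] hs i)].
Proof.
elim: us v n vs hs => [|u us IH] v n [|v' vs] [|h hs] //= <- //.
  by move=> _ _; apply/esym/forallP => -[].
move=> [szv] [szh]; rewrite (forall_ordS _ (fun i => row_ok (nth [::] (u :: us) i)
  (nth [::] (v :: v' :: vs) i) (nth [::] (v' :: vs) i) (nth [::] (h :: hs) i))).
by rewrite (IH _ (size us)).
Qed.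

Section Rows.
Variable R : comPzRingType.

Lemma chain_row x y (F : seq label -> R) w :
  chain (@row_wt R) x y F w =
  \sum_(u : (size w).+1.-tuple label) \sum_(w1 : (size w).-tuple label)
    \sum_(h : (size w).-tuple label)
      [&& head l0 u == x, last l0 u == y & row_ok u w w1 h]%:R * F w1.
Proof.
elim: w x F => [|v w IH] x F /=.
  rewrite (big_tupleS _ (fun u : seq label => \sum_(w1 : 0.-tuple label) \sum_(h :
    0.-tuple label)
     [&& head l0 u == x, last l0 u == y & row_ok u [::] w1 h]%:R * F w1)).
  rewrite (bigD1 x) //= [X in _ = _ + X]big1 => [|u /negPf ux]; last first.
    by rewrite big1 // => s _; rewrite big1 // => w1 _; rewrite big1 // => h _;
      rewrite ux mul0r.
  rewrite (big_tuple0 (fun s => \sum_(w1 : 0.-tuple label) \sum_(h : 0.-tuple label)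
     [&& x == x, last x s == y & row_ok (x :: s) [::] w1 h]%:R * F w1)).
  rewrite (big_tuple0 (fun w1 => \sum_(h : 0.-tuple label)
     [&& x == x, last x [::] == y & row_ok [:: x] [::] w1 h]%:R * F w1)).
  rewrite (big_tuple0 (fun h =>
     [&& x == x, last x [::] == y & row_ok [:: x] [::] [::] h]%:R * F [::])).
  rewrite eqxx /= addr0; congr (_%:R * _); rewrite andbC.
  suff -> : row_ok [:: x] [::] [::] [::] by [].
  by apply/forallP => -[].
transitivity (\sum_(u : (size w).+1.-tuple label) \sum_v' \sum_(w1 : (size w).-tuple
  label)
   \sum_h0 \sum_(h : (size w).-tuple label)
      [&& last x (x :: u) == y & row_ok (x :: u) (v :: w) (v' :: w1) (h0 :: h)]%:R * F
        (v' :: w1)).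
  (* At spectral parameter 0 the weight counts the labels of the horizontal diagonal. *)
  have row_wtE v' u1 : row_wt R x v v' u1 = \sum_h0
      (allowed_piece x v' h0 && allowed_piece h0 u1 v)%:R.
    by rewrite /row_wt /wt mul0r addr0 rhombusE natr_sum.
  transitivity (\sum_u1 \sum_v' \sum_(u : (size w).+1.-tuple label)
    \sum_(w1 : (size w).-tuple label) \sum_(h : (size w).-tuple label) \sum_h0
      (u1 == head l0 u)%:R * ([&& last x (x :: u) == y &
        row_ok (x :: u) (v :: w) (v' :: w1) (h0 :: h)]%:R * F (v' :: w1))).
    apply: eq_bigr => u1 _; apply: eq_bigr => v' _; rewrite IH.
    rewrite mulr_sumr; apply: eq_bigr => u _.
    rewrite mulr_sumr; apply: eq_bigr => w1 _.
    rewrite mulr_sumr; apply: eq_bigr => h _.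
    rewrite row_wtE mulr_suml; apply: eq_bigr => h0 _.
    rewrite row_ok_cons [u1 == _]eq_sym.
    have -> : last x (x :: u) = last l0 u by case: u => -[].
    have [->|] := eqVneq (head l0 u) u1; last by rewrite !mul0r mulr0.
    rewrite mul1r mulrA -natrM mulnb /=; congr (_%:R * _).
    by rewrite andbCA andbA.
  rewrite exchange_big [RHS]exchange_big; apply: eq_bigr => v' _ /=.
  rewrite exchange_big; apply: eq_bigr => u _ /=.
  rewrite exchange_big; apply: eq_bigr => w1 _ /=.
  rewrite exchange_big [RHS]exchange_big; apply: eq_bigr => h _ /=.
  rewrite exchange_big; apply: eq_bigr => h0 _ /=.
  rewrite (bigD1 (head l0 u)) //= eqxx mul1r big1 ?addr0 // => u1 /negPf ->.
  by rewrite mul0r.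
rewrite (big_tupleS _ (fun u : seq label => \sum_(w1 : (size w).+1.-tuple label)
  \sum_(h : (size w).+1.-tuple label)
   [&& head l0 u == x, last l0 u == y & row_ok u (v :: w) w1 h]%:R * F w1)).
rewrite [RHS](bigD1 x) //= [X in _ + X]big1 => [|u /negPf ux]; last first.
  by rewrite big1 // => s _; rewrite big1 // => w1 _; rewrite big1 // => h _;
    rewrite ux mul0r.
rewrite addr0; apply: eq_bigr => u _.
rewrite (big_tupleS _ (fun w1 : seq label => \sum_(h : (size w).+1.-tuple label)
   [&& x == x, last x u == y & row_ok (x :: u) (v :: w) w1 h]%:R * F w1)).
apply: eq_bigr => v' _; apply: eq_bigr => w1 _.
rewrite (big_tupleS _ (fun h : seq label => 
   [&& x == x, last x u == y & row_ok (x :: u) (v :: w) (v' :: w1) h]%:R * F (v' ::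
     w1))).
by rewrite eqxx.
Qed.

Definition filling_ok (xs ys t w : seq label) (us vs hs : seq (seq label)) :=
  [&& map (head l0) us == xs, map (last l0) us == ys, last w vs == t
    & rows_ok us w vs hs].

Lemma stack_rows a xs ys t (w : a.-tuple label) : size xs = size ys ->
  stack xs ys (@dirac R t) w =
  \sum_(us : (size xs).-tuple (a.+1.-tuple label))
  \sum_(vs : (size xs).-tuple (a.-tuple label))
  \sum_(hs : (size xs).-tuple (a.-tuple label))
    (filling_ok xs ys t w (map val us) (map val vs) (map val hs))%:R.
Proof.
pose G xs ys (w : seq label) (us : seq (a.+1.-tuple label))
    (vs hs : seq (a.-tuple label)) : R :=
  (filling_ok xs ys t w (map val us) (map val vs) (map val hs))%:R.
elim: xs ys w => [|x xs IH] [|y ys] w // => [_|[sz]].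
  rewrite (big_tuple0 (fun us => \sum_(vs : 0.-tuple _) \sum_(hs : 0.-tuple _)
    G [::] [::] w us vs hs)).
  rewrite (big_tuple0 (fun vs => \sum_(hs : 0.-tuple _) G [::] [::] w [::] vs hs)).
  rewrite (big_tuple0 (fun hs => G [::] [::] w [::] [::] hs)).
  by rewrite /G /filling_ok /= andbT.
rewrite /= chain_row size_tuple.
set n := size xs.
rewrite (big_tupleS n (fun us => \sum_(vs : n.+1.-tuple _) \sum_(hs : n.+1.-tuple _)
    G (x :: xs) (y :: ys) w us vs hs)).
apply: eq_bigr => u _.
transitivity (\sum_(us : n.-tuple (a.+1.-tuple label)) \sum_(v : a.-tuple label)
  \sum_(vs : n.-tuple (a.-tuple label)) \sum_(h : a.-tuple label)
  \sum_(hs : n.-tuple (a.-tuple label)) G (x :: xs) (y :: ys) w (u :: us) (v :: vs) (h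
    :: hs)).
  transitivity (\sum_(v : a.-tuple label) \sum_(h : a.-tuple label)
    \sum_(us : n.-tuple (a.+1.-tuple label))
    \sum_(vs : n.-tuple (a.-tuple label)) 
    \sum_(hs : n.-tuple (a.-tuple label))
      G (x :: xs) (y :: ys) w (u :: us) (v :: vs) (h :: hs)).
    apply: eq_bigr => v _; apply: eq_bigr => h _.
    rewrite (IH _ v sz) !mulr_sumr; apply: eq_bigr => us _.
    rewrite mulr_sumr; apply: eq_bigr => vs _.
    rewrite mulr_sumr; apply: eq_bigr => hs _.
    rewrite -natrM mulnb /G /filling_ok /= !eqseq_cons; congr (nat_of_bool _)%:R.
    by do !case: (_ == _) => //=; rewrite ?andbF // andbT.
  rewrite [RHS]exchange_big; apply: eq_bigr => v _ /=.
  rewrite exchange_big; apply: eq_bigr => us _ /=.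
  by rewrite exchange_big.
apply: eq_bigr => us _.
rewrite (big_tupleS n (fun vs => \sum_(hs : n.+1.-tuple _)
    G (x :: xs) (y :: ys) w (u :: us) vs hs)).
apply: eq_bigr => v _; apply: eq_bigr => vs _.
by rewrite (big_tupleS n (fun hs => G (x :: xs) (y :: ys) w (u :: us) (v :: vs) hs)).
Qed.

End Rows.

Definition mx_of_rows T m n (s : m.-tuple (n.-tuple T)) : 'M[T]_(m, n) :=
  \matrix_(i, j) tnth (tnth s i) j.

Lemma sum_mx_of_rows (V : nmodType) (T : finType) m n (F : 'M[T]_(m, n) -> V) :
  \sum_M F M = \sum_(s : m.-tuple (n.-tuple T)) F (mx_of_rows s).
Proof.
rewrite (reindex (@mx_of_rows T m n)) //=.
exists (fun M => [tuple [tuple M i j | j < n] | i < m]) => [s _|M _].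
  apply: eq_from_tnth => i; apply: eq_from_tnth => j.
  by rewrite !tnth_mktuple mxE.
by apply/matrixP => i j; rewrite mxE !tnth_mktuple.
Qed.

Section Count.
Variables a c : nat.
Implicit Types (us : c.-tuple (a.+1.-tuple label)) (v : a.-tuple label)
  (vs hs : c.-tuple (a.-tuple label)).

Lemma mx_of_rowsE T m n (s : m.-tuple (n.-tuple T)) x0 i j :
  mx_of_rows s i j = nth x0 (nth [::] (map val s) i) j.
Proof.
rewrite mxE (nth_map (tnth s i)) ?size_tuple // -(tnth_nth (tnth s i) s i).
by rewrite -tnth_nth.
Qed.

Lemma all_pieces_allowed_rows us v vs hs :
  all_pieces_allowed (mx_of_rows us) (mx_of_rows [tuple of v :: vs]) (mx_of_rows hs) =
  rows_ok (map val us) v (map val vs) (map val hs).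
Proof.
rewrite (@rows_okE c) ?size_map ?size_tuple //.
apply/eq_forallb => i.
have szv : size (nth [::] (val v :: map val vs) i) = a.
  rewrite (nth_map v _ val (s := v :: vs)) ?size_tuple //=.
  by rewrite ltnS ltnW.
rewrite (row_okE _ _ _ szv).
apply/eq_forallb => j.
by rewrite /= !(mx_of_rowsE us l0) !(mx_of_rowsE hs l0)
  !(mx_of_rowsE [tuple of v :: vs] l0).
Qed.

Lemma boundary_is_rows us v vs SW NW NE SE :
  boundary_is (mx_of_rows us) (mx_of_rows [tuple of v :: vs]) SW NW NE SE =
  (val v == rev (map Some SW)) &&
  [&& map (head l0) (map val us) == map Some NW,
      map (last l0) (map val us) == rev (map Some SE)
    & last (val v) (map val vs) == map Some NE].
Proof.
have rowE (s : c.+1.-tuple (a.-tuple label)) i :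
    [seq mx_of_rows s i j | j <- enum 'I_a] = val (tnth s i).
  rewrite -[RHS](map_tnth_enum (tnth s i)); apply: eq_map => j; exact: mxE.
rewrite /boundary_is !rowE tnth0 /=.
have -> : val (tnth [tuple of v :: vs] ord_max) = last (val v) (map val vs).
  by rewrite (tnth_nth v) /= last_map (last_nth v) size_tuple.
have colE (p : 'I_a.+1) : [seq mx_of_rows us i p | i <- enum 'I_c] =
    [seq nth l0 (val u) p | u <- us].
  rewrite -[in RHS](map_tnth_enum us) -[RHS]map_comp; apply: eq_map => i.
  by rewrite /= mxE (tnth_nth l0).
rewrite !colE -!map_comp.
have -> : [seq nth l0 (val u) (ord0 : 'I_a.+1) | u <- us] = map (head l0 \o val) us.
  by apply: eq_map => u /=; rewrite nth0.
have -> : [seq nth l0 (val u) (ord_max : 'I_a.+1) | u <- us] = map (last l0 \o val) us.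
  by apply: eq_map => u /=; rewrite (last_nth l0) size_tuple; case: u => -[].
rewrite -(inj_eq (inv_inj revK)) revK -[rev (map _ us) == _](inj_eq (inv_inj revK))
  revK.
by do !case: (_ == _).
Qed.

End Count.

Lemma Par_sum (R : comPzRingType) (a c : nat) (SW NW NE SE : seq bool) :
  size SW = a -> size NW = c -> size SE = c ->
  (Par a c SW NW NE SE)%:R = puzzle_sum R NW (rev SE) (rev SW) NE.
Proof.
move=> szSW szNW szSE.
have szw : size (labels (rev SW)) == a by rewrite size_map size_rev szSW.
rewrite /puzzle_sum (@stack_rows R a _ _ _ (Tuple szw)); last first.
  by rewrite !size_map size_rev szNW.
rewrite size_map szNW /Par -sum1_card big_mkcond /= natr_sum.
pose G (U : 'M[label]_(c, a.+1)) (V : 'M[label]_(c.+1, a)) (H : 'M[label]_(c, a)) : R :=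
  (all_pieces_allowed U V H && boundary_is U V SW NW NE SE)%:R.
transitivity (\sum_U \sum_V \sum_H G U V H).
  rewrite !pair_bigA /=; apply: eq_bigr => -[[U V] H] _.
  by rewrite inE /G; case: ifP.
rewrite sum_mx_of_rows; apply: eq_bigr => us _.
rewrite sum_mx_of_rows.
pose G' (vs : c.+1.-tuple (a.-tuple label)) : R :=
  \sum_H G (mx_of_rows us) (mx_of_rows vs) H.
transitivity (\sum_v \sum_vs G' [tuple of v :: val (vs : c.-tuple (a.-tuple label))]).
  rewrite [RHS]pair_bigA /= (reindex (fun p : a.-tuple label * c.-tuple (a.-tuple
    label) =>
    [tuple of p.1 :: p.2])) //=.
  exists (fun s : c.+1.-tuple _ => (thead s, [tuple of behead s])) => [[x s] _|s _].
    by congr (_, _); apply/val_inj.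
  by rewrite -tuple_eta.
(* The SW side fixes the first row of [V]; any other value of [v] violates the boundary
   condition. *)
rewrite (bigD1 (Tuple szw)) //= [X in _ + X]big1 ?addr0 => [|v vw]; last first.
  rewrite big1 // => vs _; rewrite /G' big1 // => H _.
  rewrite /G boundary_is_rows (_ : val v == _ = false) ?andbF //.
  by apply/negbTE; rewrite -map_rev.
apply: eq_bigr => vs _; rewrite /G' sum_mx_of_rows; apply: eq_bigr => hs _.
rewrite /G all_pieces_allowed_rows boundary_is_rows /= /labels -!map_rev eqxx /=.
by rewrite andbC /filling_ok /= -!andbA.
Qed.

(** * Alternants and Littlewood-Richardson coefficients *)

Section Alternants.
Variable k : nat.
Local Notation poly := {mpoly int[k]}.

Definition alt (l : seq nat) : poly :=
  \det (\matrix_(i < k, j < k) 'X_i ^+ nth 0%N l j).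

Definition stairs (n : nat) : seq nat := rev (iota 0 n).

Definition bump_exp (l : seq nat) (S : seq bool) : seq nat :=
  [seq (p.1 + nat_of_bool p.2)%N | p <- zip l S].

Definition strict (l : seq nat) : bool := (size l == k) && sorted gtn l.

Lemma stairsS n : stairs n.+1 = n :: stairs n.
Proof. by rewrite /stairs -addn1 iotaD rev_cat. Qed.

Lemma size_stairs n : size (stairs n) = n.
Proof. by rewrite size_rev size_iota. Qed.

Lemma size_bump_exp l S : size l = size S -> size (bump_exp l S) = size l.
Proof. by move=> sz; rewrite size_map size1_zip ?sz. Qed.

Lemma nth_bump_exp l (S : seq bool) j : size l = size S ->
  nth 0%N (bump_exp l S) j = (nth 0%N l j + nth false S j)%N.
Proof.
elim: l S j => [|a l IH] [|b S] [|j] //= [sz].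
exact: IH.
Qed.

Lemma gtn_sorted_stairs n : sorted gtn (stairs n).
Proof. by rewrite /stairs rev_sorted; apply: iota_ltn_sorted. Qed.

Lemma strict_stairs : strict (stairs k).
Proof. by rewrite /strict size_stairs eqxx gtn_sorted_stairs. Qed.

(** The elementary symmetric polynomial, with subsets given by indicator tuples so as to match
    [bump_exp]. *)
Definition elem (m : nat) : poly :=
  \sum_(S : k.-tuple bool | count id S == m) \prod_i 'X_i ^+ tnth S i.

Lemma count_tuple_perm (s : 'S_k) (S : k.-tuple bool) :
  count id [tuple tnth S (s i) | i < k] = count id S.
Proof.
have /seq.permP -> // : perm_eq [tuple tnth S (s i) | i < k] S.
by apply/tuple_permP; exists s.
Qed.

(** In the Leibniz term of a permutation [s] the subset is renumbered by [s], so that the factor x_i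
    raises the entry of [l] at place [s i]. *)
Lemma alt_bump m l : size l = k ->
  elem m * alt l =
  \sum_(S : k.-tuple bool | count id S == m) alt (bump_exp l S).
Proof.
move=> szl; rewrite /alt /determinant mulr_sumr exchange_big /=.
apply: eq_bigr => s _; rewrite mulrCA -mulr_sumr; congr (_ * _).
rewrite /elem mulr_suml.
rewrite [RHS](reindex (fun S : k.-tuple bool => [tuple tnth S ((s^-1)%g i) | i < k]))
  /=; last first.
  exists (fun S : k.-tuple bool => [tuple tnth S (s i) | i < k]) => S _;
    by apply: eq_from_tnth => i; rewrite !tnth_mktuple ?permK ?permKV.
apply: eq_big => [S|S _]; first by rewrite (count_tuple_perm (s^-1)%g).
rewrite -big_split; apply: eq_bigr => i _ /=.
rewrite !mxE nth_bump_exp; last by rewrite szl size_map size_enum_ord.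
rewrite exprD mulrC; congr (_ * 'X_i ^+ nat_of_bool _).
by rewrite (nth_map i) ?size_enum_ord // nth_ord_enum permK.
Qed.

Lemma alt_repeated l i j : (i < j < k)%N -> nth 0%N l i = nth 0%N l j ->
  alt l = 0.
Proof.
case/andP=> ij jk e; rewrite /alt -det_tr.
apply: (@determinant_alternate _ _ _ (Ordinal (ltn_trans ij jk)) (Ordinal jk)).
  by rewrite -val_eqE /= ltn_eqF.
by move=> x; rewrite !mxE /= e.
Qed.

(** Raising entries by at most 1 leaves a strictly decreasing list weakly decreasing, so strictness
    can fail only by an equality of neighbours. *)
Lemma not_sorted_bump l S : size l = size S -> sorted gtn l ->
  ~~ sorted gtn (bump_exp l S) ->
  exists2 i, (i.+1 < size l)%N &
    nth 0%N (bump_exp l S) i = nth 0%N (bump_exp l S) i.+1.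
Proof.
elim: l S => [|a [|a' l] IH] [|b [|b' S]] //= sz /andP[aa' sl].
rewrite negb_and; case: leqP => [le _|_ /= h].
  by exists 0%N => //=; move: aa' le; case: b; case: b' => /=; lia.
case: (IH (b' :: S)) => //=; first by case: sz => ->.
by move=> i; exists i.+1.
Qed.

Lemma alt_bump_eq0 l S : size S = k -> strict l ->
  ~~ strict (bump_exp l S) -> alt (bump_exp l S) = 0.
Proof.
move=> szS /andP[/eqP szl sl].
rewrite /strict size_bump_exp ?szl ?szS // eqxx => /= ns.
have [] := not_sorted_bump _ sl ns; first by rewrite szl szS.
by move=> i; rewrite szl => ik; apply: alt_repeated; rewrite ltnS leqnn.
Qed.

(** Strictly decreasing lists with the same entries are equal, and only the identity permutation
    keeps such a list fixed. *)
Lemma alt_mcoeff l m : strict l -> strict m ->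
  (alt l)@_[multinom nth 0%N m i | i < k] = (l == m)%:R.
Proof.
move=> /andP[/eqP szl sl] /andP[/eqP szm sm].
have gtn_trans : transitive gtn by move=> a b c /= h1 h2; exact: ltn_trans h2 h1.
have gtn_irr : irreflexive gtn by move=> a /=; exact: ltnn.
rewrite /alt /determinant raddf_sum /=.
have termE (s : 'S_k) : ((-1) ^+ s * \prod_i (\matrix_(i, j) 'X_i ^+ nth 0%N l j) i (s
  i) : poly)@_
    [multinom nth 0%N m i | i < k] = (-1) ^+ s * [forall i, nth 0%N l (s i) == nth 0%N
      m i]%:R.
  have -> : \prod_i (\matrix_(i, j) 'X_i ^+ nth 0%N l j : 'M[poly]_k) i (s i) =
      'X_[[multinom nth 0%N l (s i) | i < k]].
    by rewrite mpolyXE_id; apply: eq_bigr => i _; rewrite !mxE mnmE.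
  have -> : [forall i, nth 0%N l (s i) == nth 0%N m i] =
      ([multinom nth 0%N l (s i) | i < k] == [multinom nth 0%N m i | i < k]).
    apply/forallP/eqP => [h|h i]; first by apply/mnmP => i; rewrite !mnmE (eqP (h i)).
    by move/mnmP/(_ i): h; rewrite !mnmE => ->.
  by rewrite !mulr_sign; case: ifP => _; rewrite ?raddfN /= mcoeffX.
rewrite (eq_bigr _ (fun s _ => termE s)).
have [e|ne] := eqVneq l m.
  rewrite -e (bigD1 1%g) //= [X in _ + X]big1 => [|s s1].
    rewrite odd_perm1 expr0 mul1r addr0.
    by rewrite (_ : [forall i, _]) //; apply/forallP => i; rewrite perm1.
  rewrite (_ : [forall i, _] = false) ?mulr0 //; apply: contraNF s1 => /forallP h.
  apply/eqP/perm.permP => i; rewrite perm1; apply/val_inj/eqP.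
  have ul := sorted_uniq gtn_trans gtn_irr sl.
  by rewrite -(nth_uniq 0%N (s := l)) ?szl //;
    [exact: h | exact: ltn_ord | exact: ltn_ord].
rewrite big1 // => s _; rewrite (_ : [forall i, _] = false) ?mulr0 //.
apply: contraNF ne => /forallP h; apply/eqP.
apply: (sorted_eq gtn_trans) => //.
  by move=> a b /=; case: ltngtP.
rewrite perm_sym -(in_tupleE l) -(in_tupleE m).
have szl' : size l == k by rewrite szl. have szm' : size m == k by rewrite szm.
suff /seq.permP hh : perm_eq (Tuple szm') (Tuple szl') by apply/seq.permP.
apply/tuple_permP; exists s; apply: (@eq_from_nth _ 0%N).
  by rewrite size_map size_enum_ord szm.
rewrite szm => i ik; rewrite (nth_map (Ordinal ik)) ?size_enum_ord //.
have -> : nth (Ordinal ik) (enum 'I_k) i = Ordinal ik.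
  by apply/val_inj; rewrite /= nth_enum_ord.
by rewrite (tnth_nth 0%N) /= (eqP (h (Ordinal ik))).
Qed.

End Alternants.

(* Among the l = bump_exp kp S with count id S = m, the one with S = first_ones m r
   has the largest weight; this makes the induction in expands_alt work. *)
Fixpoint weight (l : seq nat) : nat :=
  if l is a :: l' then ((size l').+1 * a + weight l')%N else 0%N.

Definition first_ones (m r : nat) : seq bool := nseq m true ++ nseq r false.

Definition bits_weight (S : seq bool) : nat := weight (map nat_of_bool S).

Lemma bits_weight_cons b S :
  bits_weight (b :: S) = ((size S).+1 * b + bits_weight S)%N.
Proof. by rewrite /bits_weight /= size_map. Qed.

Lemma size_first_ones m r : size (first_ones m r) = (m + r)%N.
Proof. by rewrite size_cat !size_nseq. Qed.

Lemma weight_bump l S : size l = size S ->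
  weight (bump_exp l S) = (weight l + bits_weight S)%N.
Proof.
elim: l S => [|a l IH] [|b S] //= [sz].
by rewrite -/(bump_exp l S) bits_weight_cons IH // size_bump_exp // sz; lia.
Qed.

Lemma weight_first_onesS m r :
  bits_weight (first_ones m r.+1) = (bits_weight (first_ones m r) + m)%N.
Proof.
elim: m => [|m IH]; first by rewrite bits_weight_cons muln0 addn0.
rewrite -[first_ones m.+1 _]/(true :: first_ones m _).
rewrite -[first_ones m.+1 r]/(true :: first_ones m _) !bits_weight_cons IH.
rewrite !size_first_ones; lia.
Qed.

Lemma weight_first_ones S m r : size S = (m + r)%N -> count id S = m ->
  S != first_ones m r -> (bits_weight S < bits_weight (first_ones m r))%N.
Proof.
elim: S m r => [|b S IH] m r szS.
  by case: m r szS => [|m] [|r].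
have zeros n (s : seq bool) : size s = n -> count id s = 0%N -> s = first_ones 0 n.
  by elim: s n => [|[] s IHs] [|n] //= [sz] c; rewrite (IHs n).
case: b szS => /= szS.
  case: m szS => // m szS [c] ne.
  rewrite -[first_ones m.+1 _]/(true :: first_ones m _) !bits_weight_cons.
  have -> : size S = size (first_ones m r) by rewrite size_first_ones; lia.
  rewrite ltn_add2l; apply: IH => //; first by lia.
rewrite add0n => c ne; case: r szS ne => [|r] szS ne.
  by have := count_size id S; lia.
rewrite weight_first_onesS bits_weight_cons muln0 add0n.
case: m c szS ne => [|m] c szS ne.
  by rewrite (zeros (0 + r)%N S) ?eqxx in ne; [|lia|].
have [->|neS] := eqVneq S (first_ones m.+1 r); first by lia.
by have := IH m.+1 r _ c neS; lia.
Qed.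

Lemma bump_exp_cons a l b S :
  bump_exp (a :: l) (b :: S) = (a + b)%N :: bump_exp l S.
Proof. by []. Qed.

Lemma bump_exp0 l : bump_exp l (first_ones 0 (size l)) = l.
Proof. by elim: l => //= a l IH; rewrite bump_exp_cons IH addn0. Qed.

(** All entries before the longest staircase tail r - 1, ..., 0 can be lowered by 1. On partitions
    this removes the first column. *)
Lemma strict_unbump l : sorted gtn l ->
  l = stairs (size l) \/
  exists m r kp, [/\ (0 < m)%N, (m + r = size l)%N, size kp = size l,
    sorted gtn kp & l = bump_exp kp (first_ones m r)].
Proof.
elim: l => [|a l IH]; first by left.
case: l IH => [|b l] IH.
  case: a => [|a] _; first by left.
  by right; exists 1%N, 0%N, [:: a]; rewrite /bump_exp /= addn1.
move=> sabl; have /andP[ba sl] : (b < a)%N && sorted gtn (b :: l) by [].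
case: (IH sl) => [e|[m [r [[|c kp] [m0 mr szk sk e]]]]] //.
  have eb : b = size l by move: e; rewrite /= stairsS => -[].
  have [sa|sa] : a = (size l).+1 \/ ((size l).+1 < a)%N by lia.
    by left; rewrite sa [in RHS]/= stairsS -e.
  right; exists 1%N, (size l).+1, (a.-1 :: b :: l); split=> //.
    by apply/andP; split=> //=; lia.
  rewrite -[first_ones _ _]/(true :: first_ones 0 (size (b :: l))) bump_exp_cons.
  by rewrite bump_exp0; congr (_ :: _); lia.
right; exists m.+1, r, (a.-1 :: c :: kp); split=> //.
- by rewrite addSn mr.
- by rewrite /= -[X in _ = X.+1]szk.
- apply/andP; split=> //=; move: e; case: m m0 {mr} => // m _.
  by rewrite -[first_ones _ _]/(true :: first_ones m r) bump_exp_cons => -[eb _]; lia.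
rewrite -[first_ones m.+1 _]/(true :: first_ones m r) bump_exp_cons -e.
by congr (_ :: _); lia.
Qed.

(** * Reducing products of alternants to the staircase *)

Section Expansion.
Variables (k : nat) (P : seq nat -> seq nat -> int).
Hypothesis P0l : forall l m, size l = k -> ~~ strict k l -> P l m = 0.
Hypothesis P0r : forall l m, size m = k -> ~~ strict k m -> P l m = 0.
Hypothesis P_adj : forall j l m, strict k l -> strict k m ->
  \sum_(S : k.-tuple bool | count id S == j) P (bump_exp l S) m =
  \sum_(S : k.-tuple bool | count id S == j) P l (bump_exp m S).

(* g / alt (stairs k) is a combination of Schur polynomials and p is the same
   combination of the values P (stairs k) _. *)
Definition expands (g : {mpoly int[k]}) (p : int) : Prop :=
  exists2 L : seq (int * seq nat), all (fun q => strict k q.2) L &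
    g = alt k (stairs k) * \sum_(q <- L) q.1%:~R * alt k q.2 /\
    p = \sum_(q <- L) q.1 * P (stairs k) q.2.

Lemma expands0 : expands 0 0.
Proof. by exists [::]; rewrite // !big_nil mulr0. Qed.

Lemma expandsD g1 p1 g2 p2 :
  expands g1 p1 -> expands g2 p2 -> expands (g1 + g2) (p1 + p2).
Proof.
move=> [L1 s1 [-> ->]] [L2 s2 [-> ->]]; exists (L1 ++ L2).
  by rewrite all_cat s1.
by rewrite !big_cat mulrDr.
Qed.

Lemma expandsN g p : expands g p -> expands (- g) (- p).
Proof.
move=> [L s [-> ->]]; exists [seq (- q.1, q.2) | q <- L].
  by rewrite all_map.
rewrite !big_map -mulrN -!sumrN; split; [congr (_ * _)|]; apply: eq_bigr => q _ /=.
  by rewrite mulrNz mulNr.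
by rewrite mulNr.
Qed.

Lemma expands_sum (I : finType) (A : pred I) g p :
  (forall i, A i -> expands (g i) (p i)) ->
  expands (\sum_(i | A i) g i) (\sum_(i | A i) p i).
Proof.
move=> h; elim/big_rec2: _ => [|i q g' Ai IH]; first exact: expands0.
by apply: expandsD => //; apply: h.
Qed.

(** If [l] is [kp] with its first j entries raised, then [alt k l] is e_j [alt k kp] minus the other
    bumps of [kp]; the factor e_j is passed to [alt k m]. By [P_adj], [P] obeys the same recursion,
    and bumps that are not strict contribute 0 to both. *)
Lemma expands_alt l m : strict k l -> strict k m ->
  expands (alt k l * alt k m) (P l m).
Proof.
have [n] := ubnP (weight l); elim: n l m => // n IH l m; rewrite ltnS => wl sl sm.
have [szl gl] := andP sl; have [szm gm] := andP sm.
case: (strict_unbump gl) => [e|[j [r [kp [j0 jr szk gk e]]]]].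
  rewrite (eqP szl) in e; rewrite e; exists [:: (1, m)]; first by rewrite /= sm.
  by rewrite !big_seq1 !mul1r.
rewrite (eqP szl) in jr szk.
have sk : strict k kp by rewrite /strict szk eqxx.
have szf : size (first_ones j r) == k by rewrite size_first_ones jr.
pose S0 : k.-tuple bool := Tuple szf.
have S0j : count id S0 == j by rewrite count_cat !count_nseq mul1n mul0n addn0.
have wS (S : k.-tuple bool) : count id S == j -> S != S0 ->
    (weight (bump_exp kp S) < weight l)%N.
  move=> /eqP cS neS; rewrite e !weight_bump ?size_tuple ?size_first_ones ?jr ?szk //.
  by rewrite ltn_add2l weight_first_ones // ?size_tuple ?jr.
have wk : (weight kp < weight l)%N.
  rewrite e weight_bump ?size_first_ones ?jr //; case: (j) j0 => // j' _.
  rewrite -[first_ones _ _]/(true :: first_ones j' r) bits_weight_cons; lia.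
have altE : alt k l = elem k j * alt k kp -
    \sum_(S : k.-tuple bool | (count id S == j) && (S != S0)) alt k (bump_exp kp S).
  by rewrite alt_bump // (bigD1 S0) //= addrK e.
have PE : P l m = \sum_(S : k.-tuple bool | count id S == j) P kp (bump_exp m S) -
    \sum_(S : k.-tuple bool | (count id S == j) && (S != S0)) P (bump_exp kp S) m.
  by rewrite -P_adj // (bigD1 S0) //= addrK e.
rewrite altE PE mulrBl; apply: expandsD; last apply: expandsN.
  rewrite mulrAC [_ * alt k kp]mulrC alt_bump ?(eqP szm) // mulr_sumr.
  apply: expands_sum => S _; case sS : (strict k (bump_exp m S)).
    by apply: IH => //; apply: leq_trans wk wl.
  rewrite P0r ?sS ?size_bump_exp ?size_tuple ?(eqP szm) //.
  by rewrite (alt_bump_eq0 _ sm) ?size_tuple ?sS // mulr0; exact: expands0.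
rewrite mulr_suml; apply: expands_sum => S /andP[cS neS].
case sS : (strict k (bump_exp kp S)).
  by apply: IH => //; apply: leq_trans (wS S cS neS) wl.
rewrite P0l ?sS ?size_bump_exp ?size_tuple ?szk //.
by rewrite (alt_bump_eq0 _ sk) ?size_tuple ?sS // mul0r; exact: expands0.
Qed.

End Expansion.

(** * Partitions and strictly decreasing exponents *)

Section Shift.
Variable k : nat.

Definition is_part (la : seq nat) : bool := (size la == k) && sorted geq la.

Definition shift_part (la : seq nat) : seq nat :=
  mkseq (fun j => nth 0%N la j + (k - j.+1))%N k.

Definition unshift_part (l : seq nat) : seq nat :=
  mkseq (fun j => nth 0%N l j - (k - j.+1))%N k.

Lemma alternant_shift la : alternant k la = alt k (shift_part la).
Proof.
by congr (\det _); apply/matrixP => i j; rewrite !mxE nth_mkseq.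
Qed.

Lemma shift_part_nil : shift_part [::] = stairs k.
Proof.
apply: (@eq_from_nth _ 0%N); rewrite size_mkseq ?size_stairs // => j jk.
by rewrite nth_mkseq // nth_nil nth_rev size_iota // nth_iota ?add0n //; lia.
Qed.

Lemma shift_partK la : size la = k -> unshift_part (shift_part la) = la.
Proof.
move=> sz; apply: (@eq_from_nth _ 0%N); rewrite size_mkseq ?sz // => j jk.
by rewrite !nth_mkseq // addnK.
Qed.

(** This makes the truncated subtraction in [unshift_part] exact. *)
Lemma strict_nth_ge l j : strict k l -> (j < k)%N -> (k - j.+1 <= nth 0%N l j)%N.
Proof.
case/andP=> /eqP sz /(sortedP 0%N) srt; move e: (k - j.+1)%N => n.
elim: n j e => // n IH j e jk.
by apply: leq_ltn_trans (srt j _); [apply: IH|]; lia.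
Qed.

Lemma unshift_partK l : strict k l -> shift_part (unshift_part l) = l.
Proof.
move=> sl; have [/eqP sz _] := andP sl.
apply: (@eq_from_nth _ 0%N); rewrite size_mkseq ?sz // => j jk.
by rewrite !nth_mkseq // subnK // strict_nth_ge.
Qed.

Lemma strict_shift la : is_part la -> strict k (shift_part la).
Proof.
case/andP=> /eqP sz /(sortedP 0%N) srt; rewrite /strict size_mkseq eqxx.
apply/(sortedP 0%N) => i; rewrite size_mkseq => ik; rewrite !nth_mkseq //; last by lia.
by have := srt i; rewrite sz => /(_ ik); rewrite /geq /gtn /=; lia.
Qed.

Lemma is_part_unshift l : strict k l -> is_part (unshift_part l).
Proof.
move=> sl; have [/eqP sz /(sortedP 0%N) srt] := andP sl.
rewrite /is_part size_mkseq eqxx; apply/(sortedP 0%N) => i.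
rewrite size_mkseq => ik; rewrite !nth_mkseq //; last by lia.
have := strict_nth_ge sl ik; have := srt i; rewrite sz => /(_ ik).
by rewrite /gtn /geq /=; lia.
Qed.

End Shift.

Lemma sum_fibers (V : nmodType) (I : Type) (T : eqType) (s : seq I) (r : seq T)
    (f : I -> T) (F : I -> V) :
  uniq r -> all (fun i => f i \in r) s ->
  \sum_(i <- s) F i = \sum_(t <- r) \sum_(i <- s | f i == t) F i.
Proof.
move=> ur; elim: s => [|i s IH] /=.
  by rewrite big_nil big1 // => t _; rewrite big_nil.
case/andP=> fi /IH {}IH; rewrite big_cons IH.
have -> : F i = \sum_(t <- r) if f i == t then F i else 0.
  rewrite (bigD1_seq (f i)) //= eqxx big1 ?addr0 // => t.
  by rewrite eq_sym => /negPf ->.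
rewrite -big_split; apply: eq_bigr => t _; rewrite big_cons.
by case: ifP => //= _; rewrite add0r.
Qed.

Section LittlewoodRichardson.
Variable k : nat.
Implicit Types (L : seq (int * seq nat)) (G : seq nat -> int).

(** The lists given by [expands] may repeat an exponent list; the repetitions are gathered here. *)
Definition coef_in L (l : seq nat) : int := \sum_(q <- L | q.2 == l) q.1.

Lemma sum_coef_in (R : pzRingType) L (r : seq (seq nat)) (g : seq nat -> R) :
  uniq r -> all (fun q => q.2 \in r) L ->
  \sum_(q <- L) q.1%:~R * g q.2 = \sum_(l <- r) (coef_in L l)%:~R * g l.
Proof.
move=> ur sub; rewrite (sum_fibers _ ur sub); apply: eq_bigr => l _.
rewrite rmorph_sum mulr_suml; apply: eq_bigr => q /eqP -> //.
Qed.

Lemma alt_coef_in L l : all (fun q => strict k q.2) L -> strict k l ->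
  (\sum_(q <- L) q.1%:~R * alt k q.2)@_[multinom nth 0%N l i | i < k] = coef_in L l.
Proof.
move=> sL sl; rewrite raddf_sum /= /coef_in [RHS]big_mkcond.
rewrite !big_seq; apply: eq_bigr => q qL.
rewrite mulrzl raddfMz /= alt_mcoeff ?(allP sL q qL) //.
by case: eqP => _; rewrite ?mul0rz // -mulrzr mul1r intz.
Qed.

(** Linear independence of alternants in dual form: in a relation every gathered coefficient is 0,
    so the relation persists for arbitrary values [G]. *)
Lemma alt_indep L G : all (fun q => strict k q.2) L ->
  \sum_(q <- L) q.1%:~R * alt k q.2 = 0 -> \sum_(q <- L) q.1 * G q.2 = 0.
Proof.
move=> sL sum0.
have sub : all (fun q => q.2 \in undup (map snd L)) L.
  by apply/allP => q qL; rewrite mem_undup map_f.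
transitivity (\sum_(q <- L) q.1%:~R * G q.2 : int).
  by apply: eq_bigr => q _; rewrite intz.
rewrite (sum_coef_in _ (undup_uniq _) sub) big_seq big1 // => l.
rewrite mem_undup => /mapP[q qL ->].
by rewrite -alt_coef_in ?(allP sL q qL) // sum0 mcoeff0 mul0r.
Qed.

Lemma alt_stairs_neq0 : alt k (stairs k) != 0.
Proof.
apply/eqP => e; have := alt_mcoeff (strict_stairs k) (strict_stairs k).
by rewrite e mcoeff0 eqxx.
Qed.

Local Notation expansion := {fsfun seq nat -> int with 0}.

(** Clearing denominators: the left side has two Vandermonde denominators and the right side one,
    which leaves one factor on the right. *)
Lemma schur_product_expansionE la mu (c : expansion) :
  schur_product_expansion k la mu c <->
  {in finsupp c, forall nu, is_part k nu} /\
  alt k (shift_part k la) * alt k (shift_part k mu) = alt k (stairs k) *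
    \sum_(nu <- finsupp c) (c nu)%:~R * alt k (shift_part k nu).
Proof.
set d := tofrac (alt k (stairs k)).
have d0 : d != 0 by rewrite tofrac_eq0 alt_stairs_neq0.
have schurE nu : schur k nu = tofrac (alt k (shift_part k nu)) / d.
  by rewrite /schur !alternant_shift shift_part_nil.
have sumE : \sum_(nu <- finsupp c) (c nu)%:~R * schur k nu =
    tofrac (\sum_(nu <- finsupp c) (c nu)%:~R * alt k (shift_part k nu)) / d.
  rewrite rmorph_sum mulr_suml; apply: eq_bigr => nu _.
  by rewrite schurE rmorphM rmorph_int mulrA.
have eqE : schur k la * schur k mu = \sum_(nu <- finsupp c) (c nu)%:~R * schur k nu <->
    alt k (shift_part k la) * alt k (shift_part k mu) = alt k (stairs k) *
      \sum_(nu <- finsupp c) (c nu)%:~R * alt k (shift_part k nu).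
  rewrite sumE !schurE mulrA; split=> [/(divIf d0)|/(congr1 (fun x => tofrac x))].
    move/(congr1 (fun x => x * d)); rewrite mulrAC divfK // => e.
    by apply/eqP; rewrite -tofrac_eq !tofracM e mulrC.
  by rewrite !tofracM => e; rewrite [_ / d * _]mulrAC e [d * _]mulrC mulfK.
split=> -[h1 /eqE h2]; split=> // nu /h1.
  by case=> /eqP ? ?; apply/andP.
by case/andP=> /eqP.
Qed.

Variable P : seq nat -> seq nat -> int.
Hypothesis P0l : forall l m, size l = k -> ~~ strict k l -> P l m = 0.
Hypothesis P0r : forall l m, size m = k -> ~~ strict k m -> P l m = 0.
Hypothesis P_adj : forall j l m, strict k l -> strict k m ->
  \sum_(S : k.-tuple bool | count id S == j) P (bump_exp l S) m =
  \sum_(S : k.-tuple bool | count id S == j) P l (bump_exp m S).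

Lemma schur_product_expansion_exists la mu : is_part k la -> is_part k mu ->
  exists c : expansion, schur_product_expansion k la mu c.
Proof.
move=> pla pmu.
have [L sL [altL _]] := expands_alt P0l P0r P_adj (strict_shift pla) (strict_shift pmu).
pose S : {fset seq nat} := [fset nu in map (unshift_part k) (map snd L)]%fset.
have SP nu : nu \in S -> is_part k nu.
  rewrite inE /= => /mapP[_ /mapP[q qL ->] ->].
  by rewrite is_part_unshift // (allP sL).
exists [fsfun nu in S => coef_in L (shift_part k nu) | 0].
apply/schur_product_expansionE; split=> [nu|].
  by move/(fsubsetP (finsupp_sub _ _ _)) => /SP.
rewrite altL; congr (_ * _).
rewrite (big_fset_incl _ (finsupp_sub _ _ _)) /=; last first.
  by move=> nu _; rewrite memNfinsupp => /eqP ->; rewrite mul0r.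
transitivity (\sum_(l <- map (shift_part k) S) (coef_in L l)%:~R * alt k l).
  apply: sum_coef_in.
    rewrite map_inj_in_uniq ?fset_uniq // => nu nu' /SP /andP[/eqP s1 _] /SP /andP[/eqP
      s2 _] e.
    by rewrite -(shift_partK s1) e shift_partK.
  apply/allP => q qL; rewrite -(unshift_partK (allP sL q qL)).
  by apply: map_f; rewrite inE /=; do 2!apply: map_f.
rewrite big_map !big_seq; apply: eq_bigr => nu nuS.
by rewrite fsfun_fun nuS.
Qed.

(** The expansion chosen by [epsilon] and the list from [expands_alt] are different data, but their
    difference is a relation between alternants, which [alt_indep] carries over to [P]. *)
Lemma lr_coef_sum la mu : is_part k la -> is_part k mu ->
  exists2 c : expansion, {in finsupp c, forall nu, is_part k nu} /\ lr_coef k la mu =1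
    c &
  P (shift_part k la) (shift_part k mu) =
  \sum_(nu <- finsupp c) c nu * P (stairs k) (shift_part k nu).
Proof.
move=> pla pmu; pose c := epsilon (inhabits [fsfun]) (schur_product_expansion k la mu).
have := epsilon_spec (inhabits [fsfun]) _ (schur_product_expansion_exists pla pmu).
rewrite -/c => /schur_product_expansionE[pc altc]; exists c => //.
have [L sL [altL ->]] := expands_alt P0l P0r P_adj (strict_shift pla) (strict_shift
  pmu).
have /(mulfI alt_stairs_neq0) e := etrans (esym altL) altc.
pose L' := L ++ [seq (- c nu, shift_part k nu) | nu <- finsupp c].
have sL' : all (fun q => strict k q.2) L'.
  rewrite all_cat sL; apply/allP => _ /mapP[nu nuc ->].
  by rewrite strict_shift // pc.
have alt0 : \sum_(q <- L') q.1%:~R * alt k q.2 = 0.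
  rewrite big_cat big_map /= e -big_split big1 //= => nu _.
  by rewrite mulrNz mulNr subrr.
have := alt_indep (P (stairs k)) sL' alt0.
rewrite big_cat big_map /= => /eqP; rewrite addr_eq0 => /eqP ->.
by rewrite -sumrN; apply: eq_bigr => nu _; rewrite mulNr opprK.
Qed.

End LittlewoodRichardson.

(* The exponents of the alternant of the partition of s. *)
Fixpoint expo (s : seq bool) : seq nat :=
  if s is b :: s' then if b then size s' :: expo s' else expo s' else [::].

Lemma size_expo s : size (expo s) = count id s.
Proof. by elim: s => //= -[] s /= ->. Qed.

Lemma path_expo n s : (size s <= n)%N -> path gtn n (expo s).
Proof.
elim: s n => //= -[] s IH n /= sn; last by apply: IH; lia.
by rewrite sn IH.
Qed.

Lemma expo_inj s t : size s = size t -> expo s = expo t -> s = t.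
Proof.
have below (u v : seq bool) : size u = size v -> expo u <> size v :: expo v.
  by move=> sz e; have := path_expo (leqnn (size u)); rewrite e /= sz ltnn.
elim: s t => [|b s IH] [|c t] //= [sz].
case: b c => [] [] //=; [case=> _| | |].
- by move/(IH _ sz) ->.
- by move/esym/below => /(_ (esym sz)).
- by move/below => /(_ sz).
by move/(IH _ sz) ->.
Qed.

Lemma expo_surj n l : path gtn n l -> exists2 s : n.-tuple bool, expo s = l & True.
Proof.
elim: n l => [|n IH] [|a l] //=.
- by exists [tuple].
- by case: (IH [::]) => // s e _; exists [tuple of false :: s].
case/andP; rewrite ltnS leq_eqVlt => /orP[/eqP -> /IH[s e _]|an pl].
  by exists [tuple of true :: s]; rewrite //= size_tuple e.
by case: (IH (a :: l)) => [|s e _]; [rewrite /= an|exists [tuple of false :: s]].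
Qed.

Lemma expo_part s : expo s = shift_part (count id s) (part_of_str s).
Proof.
have shiftS k a la : shift_part k.+1 (a :: la) = (a + k)%N :: shift_part k la.
  rewrite /shift_part /mkseq /= subn1 /=; congr (_ :: _).
  rewrite (iotaDl 1 0) -map_comp; apply: eq_map => j /=.
  by rewrite add1n subSS.
elim: s => //= -[] s /= ->; last by [].
by rewrite add1n shiftS addnC -[in LHS](count_predC id s).
Qed.

Lemma is_part_of_str s : is_part (count id s) (part_of_str s).
Proof.
apply/andP; split; first by elim: s => //= -[] s /= /eqP ->.
suff /path_sorted : path geq (count negb s) (part_of_str s) by [].
elim: s => //= -[] s IH /=; first by rewrite /geq /= leqnn.
by case: (part_of_str s) IH => //= a l /andP[h ->]; rewrite andbT /geq /= in h *; lia.
Qed.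

(** * The Pieri operator on exponent lists *)

Section PieriExponents.
Variables (R : comPzRingType) (z : R).

(** The path condition drops the bumps whose exponents are no longer below the length of [s], that
    is, partitions that leave the box; [z] counts the entries not raised. *)
Definition bump_sum (s : seq bool) (G : seq nat -> R) : R :=
  \sum_(S : (count id s).-tuple bool) z ^+ (count id s - count id S) *
    ((path gtn (size s) (bump_exp (expo s) S))%:R * G (bump_exp (expo s) S)).

Lemma bump_sum_true t G :
  bump_sum (true :: t) G = z * bump_sum t (fun l => G (size t :: l)).
Proof.
rewrite /bump_sum /= (big_tupleS _ (fun S : seq bool => z ^+ ((count id t).+1 - count
  id S) *
    ((path gtn (size t).+1 (bump_exp (size t :: expo t) S))%:R * G (bump_exp (size t ::
      expo t) S)))).
rewrite sum_bool [X in X + _]big1 ?add0r => [|S _]; last first.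
  by rewrite bump_exp_cons /= addn1 ltnn mul0r mulr0.
rewrite mulr_sumr; apply: eq_bigr => S _.
rewrite bump_exp_cons /= addn0 ltnSn /= add0n subSn ?exprS ?mulrA //.
by rewrite -[X in (_ <= X)%N](size_tuple S) count_size.
Qed.

Lemma path_bump_indep m m' (t : seq bool) S :
  size S = count id t -> (size t < m)%N -> (size t < m')%N ->
  path gtn m (bump_exp (expo t) S) = path gtn m' (bump_exp (expo t) S).
Proof.
move=> szS tm tm'; have := path_expo (leqnn (size t)); rewrite -size_expo in szS.
case: (expo t) S szS => [|a l] [|b S] //= _ /andP[al _].
by congr (_ && _); move: al; rewrite /gtn /=; case: b => /=; lia.
Qed.

(** The leading 0 allows the first exponent to reach [size t], which is a new possibility only if
    [t] starts with a one. *)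
Lemma bump_sum_false t G :
  bump_sum (false :: t) G =
  bump_sum t G + (if t is true :: t' then
    bump_sum (false :: t') (fun l => G (size t :: l)) else 0).
Proof.
case: t => [|[] t] /=.
- by rewrite addr0 /bump_sum /=; apply: eq_bigr => S _; case: S => -[].
- rewrite bump_sum_true {1}/bump_sum /= (big_tupleS _ (fun S : seq bool => z ^+ ((count
  id t).+1 - count id S) *
    ((path gtn (size t).+2 (bump_exp (size t :: expo t) S))%:R * G (bump_exp (size t ::
      expo t) S)))).
  rewrite sum_bool addrC /bump_sum /= mulr_sumr; congr (_ + _); apply: eq_bigr => S _.
    rewrite bump_exp_cons /= addn0 ltnS leqnSn /= add0n subSn ?exprS ?mulrA //.
    by rewrite -[X in (_ <= X)%N](size_tuple S) count_size.
  by rewrite bump_exp_cons /= addn1 ltnSn /= add1n subSS.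
rewrite addr0 /bump_sum /=; apply: eq_bigr => S _.
by rewrite (@path_bump_indep _ (size t).+1) ?size_tuple.
Qed.

Lemma sum_pieri_expo s G :
  \sum_(s' : (size s).-tuple bool) pieri z false s' s * G (expo s') = bump_sum s G.
Proof.
have cons0 t (F : seq nat -> R) : 
  \sum_(s' : (size t).+1.-tuple bool) pieri z false s' (false :: t) * F (expo s') =
  \sum_(s' : (size t).-tuple bool) pieri z false s' t * F (expo s') +
  \sum_(s' : (size t).-tuple bool) pieri z true s' t * F (size t :: expo s').
  rewrite (sum_pieri_outS z false false _ t (F \o expo)) sum_bool addrC /= !mul1r.
  by congr (_ + _); apply: eq_bigr => s' _; rewrite size_tuple.
(* With a carry, the incoming one occupies the first letter of [s], which must be 1; the remaining
   shifts are those into [s] with this letter replaced by 0. *)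
suff : (forall G, \sum_(s' : (size s).-tuple bool) pieri z false s' s * G (expo s') =
  bump_sum s G)
  /\ forall G, \sum_(s' : (size s).-tuple bool) pieri z true s' s * G (expo s') =
     if s is true :: t' then bump_sum (false :: t') G else 0 by case.
elim: s {G} => [|b s [IH0 IH1]].
  split=> G; rewrite (big_tuple0 (fun s' => pieri z _ s' [::] * G (expo s'))) /= ?mul0r
    //.
  rewrite /bump_sum (big_tuple0 (fun S : seq bool => z ^+ (0 - count id S) *
    ((path gtn 0%N (bump_exp [::] S))%:R * G (bump_exp [::] S)))).
  by rewrite /= expr0 !mul1r.
split=> G; case: b => /=.
- rewrite bump_sum_true (sum_pieri_outS z false true _ s (G \o expo)) sum_bool /= mul0r
  addr0.
  by congr (_ * _); rewrite -IH0; apply: eq_bigr => s' _; rewrite size_tuple.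
- by rewrite cons0 bump_sum_false IH0 (IH1 (fun l => G (size s :: l))).
- rewrite bump_sum_false -IH0 -(IH1 (fun l => G (size s :: l))).
  rewrite (sum_pieri_outS z true true _ s (G \o expo)) sum_bool /= !mul1r addrC.
  by congr (_ + _); apply: eq_bigr => s' _; rewrite size_tuple.
by rewrite (sum_pieri_outS z true false _ s (G \o expo)) sum_bool /= !mul0r addr0.
Qed.

End PieriExponents.

(** * From self-adjointness to Littlewood-Richardson numbers *)

Section Adjoint.
Variables (n k : nat) (Q : seq bool -> seq bool -> int).
Hypothesis Q_adj : forall s t : n.-tuple bool,
  count id s = k -> count id t = k ->
  \sum_(s' : n.-tuple bool) pieri 'X false s' s * (Q s' t)%:P =
  \sum_(t' : n.-tuple bool) pieri 'X false t' t * (Q s t')%:P.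

(** As [expo] is injective on strings of length [n], each sum has at most one term: this is [Q],
    extended by 0 to lists that come from no string. *)
Definition on_expo (l m : seq nat) : int :=
  \sum_(s : n.-tuple bool | expo s == l)
    \sum_(t : n.-tuple bool | expo t == m) Q s t.

Lemma on_expo0l l m : ~~ path gtn n l -> on_expo l m = 0.
Proof.
move=> nl; rewrite /on_expo big_pred0 // => s; apply: contraNF nl => /eqP <-.
by rewrite path_expo ?size_tuple.
Qed.

Lemma on_expo0r l m : ~~ path gtn n m -> on_expo l m = 0.
Proof.
move=> nl; rewrite /on_expo big1 // => s _; rewrite big_pred0 // => t.
by apply: contraNF nl => /eqP <-; rewrite path_expo ?size_tuple.
Qed.

Lemma on_expoE (s t : n.-tuple bool) : on_expo (expo s) (expo t) = Q s t.
Proof.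
have eqE (u v : n.-tuple bool) : (expo u == expo v) = (u == v).
  apply/eqP/eqP => [|-> //] e; apply/val_inj/(@expo_inj u v) => //.
  by rewrite !size_tuple.
rewrite /on_expo (big_pred1 s) => [|u]; last by rewrite eqE.
by rewrite (big_pred1 t) // => u; rewrite eqE.
Qed.

Lemma path_bump_le l S : size S = size l -> path gtn n (bump_exp l S) ->
  sorted gtn l -> path gtn n l.
Proof.
case: l S => [|a l] [|b S] //= _ /andP[h _] ->; rewrite andbT.
by move: h; rewrite /gtn /=; case: b => /=; lia.
Qed.

(** A list with an entry too large for length [n] keeps one after any bump, so both sides vanish;
    otherwise [Q_adj] applies. *)
Lemma on_expo_adj j l m : strict k l -> strict k m ->
  \sum_(S : k.-tuple bool | count id S == j) on_expo (bump_exp l S) m =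
  \sum_(S : k.-tuple bool | count id S == j) on_expo l (bump_exp m S).
Proof.
move=> /andP[/eqP szl sl] /andP[/eqP szm sm].
case pl : (path gtn n l); last first.
  rewrite !big1 // => S _; first by rewrite on_expo0l ?pl.
  by rewrite on_expo0l //; apply: contraFN pl => /path_bump_le; apply;
    rewrite ?size_tuple.
case pm : (path gtn n m); last first.
  rewrite !big1 // => S _; last by rewrite on_expo0r ?pm.
  by rewrite on_expo0r //; apply: contraFN pm => /path_bump_le; apply;
    rewrite ?size_tuple.
have [s es _] := expo_surj pl; have [t et _] := expo_surj pm.
have cs : count id s = k by rewrite -size_expo es.
have ct : count id t = k by rewrite -size_expo et.
have expand (u : n.-tuple bool) (H : seq nat -> int) (cu : count id u = k) :
    (forall l', ~~ path gtn n l' -> H l' = 0) ->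
    \sum_(u' : n.-tuple bool) pieri 'X false u' u * (H (expo u'))%:P =
    \sum_(S : k.-tuple bool) 'X ^+ (k - count id S) * (H (bump_exp (expo u) S))%:P.
  move=> H0; have := sum_pieri_expo 'X u (fun l' => (H l')%:P).
  rewrite /bump_sum size_tuple cu => ->; apply: eq_bigr => S _; congr (_ * _).
  have [_|/H0 ->] := boolP (path _ _ _); first by rewrite mul1r.
  by rewrite mul0r.
have := Q_adj cs ct.
rewrite (eq_bigr (fun s' : n.-tuple bool => pieri 'X false s' s * (on_expo (expo s')
  m)%:P)); last first.
  by move=> s' _; rewrite -et on_expoE.
rewrite [RHS](eq_bigr (fun t' : n.-tuple bool => pieri 'X false t' t * (on_expo l (expo
  t'))%:P)); last first.
  by move=> t' _; rewrite -es on_expoE.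
rewrite (expand s (on_expo^~ m)) // => [|l' ?]; last exact: on_expo0l.
rewrite (expand t (on_expo l)) // => [|l' ?]; last exact: on_expo0r.
(* Raising j of the k entries leaves k - j unraised, each with a factor 'X. *)
rewrite es et => /(congr1 (fun p : {poly int} => p`_(k - j))).
have coefE (H : seq bool -> int) : (j <= k)%N ->
    (\sum_(S : k.-tuple bool) 'X ^+ (k - count id S) * (H S)%:P)`_(k - j) =
    \sum_(S : k.-tuple bool | count id S == j) H S.
  move=> jk; rewrite coef_sum [RHS]big_mkcond; apply: eq_bigr => S _.
  rewrite coefMC coefXn; have -> : (k - j == k - count id S)%N = (count id S == j).
    by have := count_size id S; rewrite size_tuple; lia.
  by case: ifP; rewrite ?mul1r ?mul0r.
case: (leqP j k) => [jk|kj].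
  by rewrite (coefE (fun S => on_expo (bump_exp l S) m)) // (coefE (fun S => on_expo l
    (bump_exp m S))).
(* For [j > k] the truncated [k - j] would pick a wrong coefficient, but both sums are empty. *)
move=> _; rewrite !big_pred0 // => S; apply: ltn_eqF; apply: leq_ltn_trans kj;
  by rewrite -[X in (_ <= X)%N](size_tuple S) count_size.
Qed.

Definition unit_str : seq bool := nseq (n - k) false ++ nseq k true.

Lemma expo_unit_str : expo unit_str = stairs k.
Proof.
rewrite /unit_str; elim: (n - k)%N => //=.
by elim: (k) => //= m ->; rewrite size_nseq stairsS.
Qed.

(** Partitions outside the box have no string and [on_expo] is 0 on them, which cuts the polynomial
    expansion down to a sum over strings. *)
Lemma lr_of_adjoint al be : al \in binstr n k -> be \in binstr n k ->
  Q al be = \sum_(nu : n.-tuple bool | tval nu \in binstr n k)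
    lr_str k al be nu * Q unit_str nu.
Proof.
rewrite !inE => /andP[sza /eqP ca] /andP[szb /eqP cb].
have k_le : (k <= n)%N by rewrite -ca -(eqP sza) count_size.
have part_al := is_part_of_str al; rewrite ca in part_al.
have part_be := is_part_of_str be; rewrite cb in part_be.
have P0l l m : size l = k -> ~~ strict k l -> on_expo l m = 0.
  move=> szl; rewrite /strict szl eqxx => nl; apply: on_expo0l.
  by apply: contraNN nl => /path_sorted.
have P0r l m : size m = k -> ~~ strict k m -> on_expo l m = 0.
  move=> szl; rewrite /strict szl eqxx => nl; apply: on_expo0r.
  by apply: contraNN nl => /path_sorted.
have [c [pc lrE]] := lr_coef_sum P0l P0r on_expo_adj part_al part_be.
rewrite -{1}ca -{1}cb -!expo_part.
rewrite -[al]/(val (Tuple sza)) -[be]/(val (Tuple szb)) on_expoE => ->.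
rewrite /lr_str /=.
have szu : size unit_str == n by rewrite size_cat !size_nseq subnK.
transitivity (\sum_(nu : n.-tuple bool | tval nu \in binstr n k)
    c (part_of_str nu) * on_expo (stairs k) (expo nu)); last first.
  apply: eq_bigr => nu _; rewrite lrE -expo_unit_str.
  by rewrite -[unit_str]/(val (Tuple szu)) on_expoE.
pose F nu := c nu * on_expo (stairs k) (shift_part k nu).
(* Each term is spread over the support of [c] so that the sums over strings and over partitions can
   be exchanged. *)
have FE (t : n.-tuple bool) : tval t \in binstr n k ->
    c (part_of_str t) * on_expo (stairs k) (expo t) =
    \sum_(nu <- finsupp c) if part_of_str t == nu then F nu else 0.
  rewrite inE => /andP[_ /eqP ct]; rewrite expo_part ct -/(F _).
  have [tc|tc] := boolP (part_of_str t \in finsupp c).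
    rewrite (bigD1_seq (part_of_str t)) ?fset_uniq //= eqxx big1 ?addr0 // => nu.
    by rewrite eq_sym => /negPf ->.
  rewrite big_seq big1 => [|nu nuc].
    by move: tc; rewrite memNfinsupp /F => /eqP ->; rewrite mul0r.
  by case: eqP => // e; rewrite e nuc in tc.
rewrite (eq_bigr _ FE) exchange_big /= !big_seq; apply: eq_bigr => nu nuc.
have pnu := pc nu nuc; have [/eqP sznu _] := andP pnu.
rewrite -/(F nu) -big_mkcondr /=.
have [/expo_surj[t et _]|npath] := boolP (path gtn n (shift_part k nu)); last first.
  by rewrite {1}/F on_expo0r // mulr0 big1 // => t _; rewrite /F on_expo0r // mulr0.
have ct : count id t = k by rewrite -size_expo et size_mkseq.
have pt : part_of_str t = nu.
  have /andP[/eqP szp _] := is_part_of_str t.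
  by rewrite -(shift_partK sznu) -et expo_part ct shift_partK // szp.
rewrite (big_pred1 t) // => u /=; rewrite !inE size_tuple eqxx /=.
apply/andP/eqP => [[/eqP cu /eqP pu]|->]; last by rewrite ct pt !eqxx.
apply/val_inj/(@expo_inj u t); first by rewrite !size_tuple.
by rewrite !expo_part cu ct pu pt.
Qed.

End Adjoint.

(** * Puzzles with identity strings on the SW and NW sides *)

Definition sorted_str (p q : nat) : seq bool := nseq p true ++ nseq q false.

Definition marked (s : seq bool) : seq label := map carry s.

(* When SW and NW carry the identity strings, the rows of a puzzle are forced: the
   word between two rows is s 1^p 0^q with s a word in 0, 1 and 10, and
   completion p q ys is what 1^p 0^q becomes at the NE side if the remaining
   labels of the SE side are ys (None if there is no such puzzle). *)
Fixpoint completion (p q : nat) (ys : seq bool) : option (seq bool) :=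
  if all id ys then Some (sorted_str p q) else
  if ys is y :: ys' then
    match p, y, q with
    | 0, true, _ => None
    | 0, false, _ => completion 0 q ys'
    | p'.+1, true, _ => omap (cons true) (completion p' q ys')
    | _.+1, false, 0 => None
    | _.+1, false, q'.+1 => omap (cons false) (completion p q' ys')
    end
  else None.

Section BaseCase.
Variable R : comPzRingType.
Implicit Types (F : seq label -> R).
Local Notation row := (@row_wt R).

Lemma chain_row_marked y F s w :
  chain row l0 y F (marked s ++ w) =
  chain row l0 y (fun t => F (marked s ++ t)) w.
Proof.
elim: s F => [|b s IH] F //=.
by rewrite !sum_label !(IH (fun t => F (_ :: t))); case: b;
  rewrite /row_wt /wt /= !simp.
Qed.

Lemma chain_row_labels y F s w :
  chain row l1 y F (labels s ++ w) =
  chain row l1 y (fun t => F (labels s ++ t)) w.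
Proof.
elim: s F => [|b s IH] F //=.
by rewrite !sum_label !(IH (fun t => F (_ :: t))); case: b;
  rewrite /row_wt /wt /= !simp.
Qed.

Lemma chain_row_labels_end y F s :
  chain row l1 y F (labels s) = (l1 == y)%:R * F (labels s).
Proof. by rewrite -[labels s]cats0 chain_row_labels. Qed.

Lemma chain_row_unmark y F w :
  chain row l1 y F (l10 :: w) = chain row l0 y (fun t => F (l1 :: t)) w.
Proof. by rewrite /= !sum_label /row_wt /wt /= !simp. Qed.

Lemma marked_zeros q : marked (nseq q false) = labels (nseq q false).
Proof. by rewrite /marked /labels !map_nseq. Qed.

(** The state 10 runs through the ones and is absorbed by the first 0, which becomes 1. *)
Lemma chain_row_shift y F p q :
  chain row l10 (Some y) F (labels (sorted_str p q)) =
  if q is q'.+1 then (~~ y)%:R * F (labels (sorted_str p.+1 q')) else 0.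
Proof.
elim: p F => [|p IH] F.
  case: q => [|q] /=; first by rewrite mul0r.
  rewrite -marked_zeros !sum_label /row_wt /wt /= !simp.
  rewrite -[marked _]cats0 chain_row_marked /= cats0 marked_zeros.
  by case: y.
rewrite [sorted_str _ _]/= [labels _]/= -/(sorted_str p q) -/(labels (sorted_str p q)).
rewrite [LHS]/= !sum_label !(IH (fun t => F (_ :: t))) /row_wt /wt /= !simp.
by case: q {IH}.
Qed.

(** The only choice is at the first 1 after the marked part: either it turns into 10 and the state 1
    runs to the end, or it turns into 0 and the state 10 goes on. The exit label [y] decides. *)
Lemma chain_row_sorted (y : bool) F s p q :
  chain row l0 (Some y) F (marked s ++ labels (sorted_str p q)) =
  match p, y, q with
  | 0, true, _ => 0
  | 0, false, _ => F (marked s ++ labels (sorted_str 0 q))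
  | p'.+1, true, _ => F (marked (rcons s true) ++ labels (sorted_str p' q))
  | _.+1, false, 0 => 0
  | _.+1, false, q'.+1 => F (marked (rcons s false) ++ labels (sorted_str p q'))
  end.
Proof.
rewrite chain_row_marked; case: p => [|p].
  rewrite /sorted_str /= -marked_zeros -[marked (nseq _ _)]cats0 chain_row_marked.
  by case: y; rewrite /= !simp.
rewrite [sorted_str _ _]/= [labels _]/= -/(sorted_str p q) -/(labels (sorted_str p q)).
rewrite [LHS]/= !sum_label !chain_row_shift -[labels (sorted_str p q)]cats0.
rewrite !chain_row_labels /row_wt /wt /= !simp !cats0.
by case: y; case: q => [|q]; rewrite !simp // -cats1 /marked map_cat -catA.
Qed.

#[local] Arguments sorted_str : simpl never.

(** A row entered with 0 only extends [s2]. A row entered with 1 first turns the first 10 of [s2]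
    into 1, and the word up to there joins [s1]. The condition on counts, preserved by the rows,
    says that the zeros still to leave are those still to enter and the marks in [s2]. *)
Lemma stack_completion i j ys s1 s2 p q F :
  size ys = (i + j)%N -> count negb ys = (i + count id s2)%N ->
  (0 < i)%N ==> (s1 == [::]) ->
  stack (labels (nseq i false ++ nseq j true)) (labels ys) F
    (labels s1 ++ marked s2 ++ labels (sorted_str p q)) =
  if completion p q ys is Some t then F (labels (s1 ++ s2 ++ t)) else 0.
Proof.
have marked0 s : count id s = 0%N -> marked s = labels s.
  by elim: s => //= -[] s IH //= c; rewrite IH.
have first_one s : (0 < count id s)%N -> exists m s', s = nseq m false ++ true :: s'.
  elim: s => //= -[] s IH c; first by exists 0%N, s.
  by have [m [s' ->]] := IH c; exists m.+1, s'.
have catE s t : labels (s ++ t) = labels s ++ labels t by rewrite /labels map_cat.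
elim: ys i j s1 s2 p q => [|y ys IH] i j s1 s2 p q.
  case: i j => [|i] [|j] //= _ /esym/marked0 -> _.
  by rewrite /labels !map_cat; case: p.
case: i => [|i] szy cnt.
  case: j szy => // j [szy] _.
  rewrite [labels (_ ++ _)]/= -/(labels (nseq 0 false ++ nseq j true)) [labels (y ::
    ys)]/= -/(labels ys) [stack _ _ _ _]/=.
  (* Without marks, the count forces all remaining exit labels to be 1, and the rows change
     nothing. *)
  have [s20|] := eqVneq (count id s2) 0%N.
    have ally : all id (y :: ys).
      by rewrite all_count -[X in _ == X](count_predC id (y :: ys)) [X in (_ + X)%N]cnt
        s20 !addn0.
    have /andP[/= yt ally'] := ally.
    rewrite marked0 // -!catE chain_row_labels_end yt mul1r.
    have cnt' : count negb ys = (0 + count id (Nil bool))%N by move: cnt;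
      rewrite yt s20.
    have := IH 0%N j (s1 ++ s2 ++ sorted_str p q) [::] 0%N 0%N szy cnt' isT.
    rewrite /= cats0 => ->.
    by case: (ys) ally' => [|y' ys'] /= al; rewrite ?al /= /sorted_str /= !cats0 ?catA.
  rewrite -lt0n => /first_one[m [s' es2]]; rewrite es2 in cnt *.
  have cs' : count negb (y :: ys) = (count id s').+1.
    by rewrite cnt count_cat count_nseq mul0n.
  have -> : completion p q (y :: ys) =
      match p, y, q with
      | 0, true, _ => None
      | 0, false, _ => completion 0 q ys
      | p'.+1, true, _ => omap (cons true) (completion p' q ys)
      | _.+1, false, 0 => None
      | _.+1, false, q'.+1 => omap (cons false) (completion p q' ys)
      end.
    rewrite [LHS]/=; case: ifP => // /andP[yt]; rewrite all_count => /eqP cy.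
    by move: cs'; rewrite /= yt count_negb cy subnn.
  have -> : labels s1 ++ marked (nseq m false ++ true :: s') ++ labels (sorted_str p q)
    =
      labels (s1 ++ nseq m false) ++ l10 :: (marked s' ++ labels (sorted_str p q)).
    by rewrite /marked map_cat /= -/(marked (nseq m false)) marked_zeros catE -!catA.
  rewrite chain_row_labels chain_row_unmark chain_row_sorted.
  have IHj s p' q' : count negb ys = count id s ->
      stack (labels (nseq j true)) (labels ys) F
        (labels (s1 ++ nseq m false) ++ l1 :: (marked s ++ labels (sorted_str p' q'))) =
      if completion p' q' ys is Some t
      then F (labels (s1 ++ (nseq m false ++ true :: s) ++ t)) else 0.
    move=> cs; have := IH 0%N j (s1 ++ nseq m false ++ [:: true]) s p' q' szy cs isT.
    rewrite /= !catE -!catA /= => ->; case: (completion _ _ _) => // t.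
    by rewrite !catE -!catA.
  move: cs' => /=; case: p q y {szy cnt IH} => [|p] q [] cs'; cbv beta iota => //.
  - by rewrite IHj //; lia.
  - rewrite IHj; last by rewrite -cats1 count_cat /=; lia.
    by case: completion => //= t; rewrite -!catA /= cat_rcons.
  case: q => [|q]; cbv beta iota; first by [].
  rewrite IHj; last by rewrite -cats1 count_cat /=; lia.
  by case: completion => //= t; rewrite -!catA /= cat_rcons.
rewrite [_ ==> _]/= => /eqP s10; move: szy => [szy].
have -> : completion p q (y :: ys) =
    match p, y, q with
    | 0, true, _ => None
    | 0, false, _ => completion 0 q ys
    | p'.+1, true, _ => omap (cons true) (completion p' q ys)
    | _.+1, false, 0 => None
    | _.+1, false, q'.+1 => omap (cons false) (completion p q' ys)
    end.
  rewrite [LHS]/=; case: ifP => // /andP[yt]; rewrite all_count => /eqP cy.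
  by move: cnt; rewrite /= yt count_negb cy subnn.
rewrite s10 [labels [::] ++ _]/= [labels (nseq i.+1 false ++ _)]/=.
rewrite -/(labels (nseq i false ++ nseq j true)) [labels (y :: ys)]/= -/(labels ys).
rewrite [stack _ _ _ _]/= chain_row_sorted.
have IHi s p' q' : count negb ys = (i + count id s)%N ->
    stack (labels (nseq i false ++ nseq j true)) (labels ys) F
      (marked s ++ labels (sorted_str p' q')) =
    if completion p' q' ys is Some t then F (labels (s ++ t)) else 0.
  by move=> cs; rewrite -(IH i j [::] s p' q' szy cs) ?eqxx ?implybT.
move: cnt => /=; case: p q y => [|p] q [] cnt; cbv beta iota => //.
- by rewrite IHi //; lia.
- rewrite IHi; last by rewrite -cats1 count_cat /=; lia.
  by case: completion => //= t; rewrite cat_rcons.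
case: q => [|q]; cbv beta iota; first by [].
  rewrite IHi; last by rewrite -cats1 count_cat /=; lia.
by case: completion => //= t; rewrite cat_rcons.
Qed.

End BaseCase.

(** * Explicit form of the completions *)

Lemma all_id_nseq y : all id y -> y = nseq (size y) true.
Proof. by elim: y => //= -[] y IH // /IH {1}->. Qed.

Lemma completion_all p q y : all id y -> completion p q y = Some (sorted_str p q).
Proof. by case: y => //= b y ->. Qed.

Lemma completion_cons p q b y : ~~ all id (b :: y) ->
  completion p q (b :: y) =
    match p, b, q with
    | 0, true, _ => None
    | 0, false, _ => completion 0 q y
    | p'.+1, true, _ => omap (cons true) (completion p' q y)
    | _.+1, false, 0 => None
    | _.+1, false, q'.+1 => omap (cons false) (completion p q' y)
    end.
Proof. by rewrite /= => /negPf ->. Qed.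

Lemma count_id_all y : all id y -> count id y = size y /\ count negb y = 0%N.
Proof. by elim: y => //= -[] y IH // /IH[-> ->]. Qed.

Lemma completion0 q y : completion 0 q y =
  if y == nseq (count negb y) false ++ nseq (count id y) true
  then Some (nseq q false) else None.
Proof.
elim: y => [|b y IH] //; have [al|nal] := boolP (all id (b :: y)).
  rewrite completion_all //; have [-> ->] := count_id_all al.
  by rewrite {1}(all_id_nseq al) eqxx.
rewrite completion_cons //; case: b nal => /= nal; last by rewrite IH.
case: ifP => // /eqP e; case/negP: nal.
by case: (count negb y) e => //= -[->]; rewrite all_nseq orbT.
Qed.

(** [completion] copies [y] from a stock of p ones and q zeros; here the ones do not run out, so
    only a lack of zeros can stop it. *)
Lemma completion_short p q y : (count id y < p)%N ->
  completion p q y = if (count negb y <= q)%N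
    then Some (y ++ sorted_str (p - count id y) (q - count negb y)) else None.
Proof.
elim: y p q => [|b y IH] p q yp.
  by rewrite /= !subn0.
have [al|nal] := boolP (all id (b :: y)).
  rewrite completion_all //; have [e ->] := count_id_all al.
  rewrite e in yp *; rewrite leq0n subn0.
  move: yp (all_id_nseq al); set n := size _ => yp ->; rewrite /sorted_str catA.
  by rewrite -nseqD subnKC // ltnW.
rewrite completion_cons //; case: p yp => // p; case: b {nal} => /= yp.
  by rewrite IH // !add0n add1n subSS; case: ifP.
case: q => [|q]; first by rewrite add1n.
by rewrite IH // !add1n add0n ltnS subSS; case: ifP.
Qed.

Lemma completion_cat_ones p q s m : count id s = p -> (count negb s <= q)%N ->
  completion p q (s ++ nseq m true) = Some (s ++ nseq (q - count negb s) false).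
Proof.
have all1 n : all id (nseq n true) by rewrite all_nseq orbT.
elim: s p q => [|b s IH] p q <- sq; first by rewrite completion_all //= subn0.
rewrite cat_cons.
have [al|nal] := boolP (all id (b :: s)).
  rewrite completion_all; last by rewrite -cat_cons all_cat al all1.
  move: al; rewrite /= => /andP[-> als]; have [e ->] := count_id_all als.
  rewrite e; move: (all_id_nseq als); set n := size s => ->.
  by rewrite /sorted_str /= subn0.
rewrite completion_cons; last by rewrite -cat_cons all_cat negb_and nal.
case: b nal sq => /= nal sq; first by rewrite IH.
(* After the last one of the string, zeros are no longer taken from the stock; the output ends in
   zeros in any case, and the totals agree. *)
case e: (count id s) => [|n] /=; last first.
  by case: q sq => // q sq; rewrite add0n (IH n.+1).
rewrite (IH 0%N) //; last by lia.
have zs : s = nseq (size s) false by elim: (s) e => //= -[] u IHu // /IHu {1}->.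
have -> : count negb s = size s by rewrite count_negb e subn0.
rewrite zs size_nseq -nseqD -cat_cons -[false :: nseq _ _]/(nseq _.+1 _) -nseqD.
by congr (Some (nseq _ _)); move: sq; rewrite count_negb e; lia.
Qed.

Lemma completion_long p q y u : (p <= count id y)%N -> (count negb y <= q)%N ->
  completion p q y = Some u ->
  exists2 s, count id s = p /\ count negb s = count negb y &
    y = s ++ nseq (count id y - p) true /\
    u = s ++ nseq (q - count negb y) false.
Proof.
elim: y p q u => [|b y IH] p q u py yq.
  by case: p py => // _ [<-]; exists [::]; rewrite //= subn0.
have [al|nal] := boolP (all id (b :: y)).
  rewrite completion_all // => -[<-]; have [e e'] := count_id_all al.
  exists (nseq p true); first by rewrite !count_nseq mul1n mul0n e'.
  rewrite e' subn0 -nseqD subnKC // e; split=> //; exact: all_id_nseq.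
case: p py => [|p] py.
  rewrite completion0; case: ifP => // /eqP ey [<-].
  exists (nseq (count negb (b :: y)) false); first by rewrite !count_nseq mul0n mul1n.
  by rewrite subn0 -nseqD subnKC.
rewrite completion_cons //; case: b nal py yq => /= nal py yq.
  case ec: completion => [u'|] //= -[<-].
  have [s [s1 s2] [e1 e2]] := IH _ _ _ py yq ec.
  by exists (true :: s); rewrite /= ?s1 ?s2 // subSS -e1 -e2.
case: q yq => // q yq; case ec: completion => [u'|] //= -[<-].
have [s [s1 s2] [e1 e2]] := IH _ _ _ py yq ec.
by exists (false :: s); rewrite /= ?s1 ?s2 // subSS -e1 -e2.
Qed.

(** The nonempty block of zeros keeps the test [all id] false along the whole of [s]. *)
Lemma completion_cat_zeros s r m : 
  completion (count id s) (count negb s) (s ++ nseq r.+1 false ++ nseq m true) = Some s.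
Proof.
have nall t : ~~ all id (t ++ nseq r.+1 false ++ nseq m true).
  by rewrite !all_cat /= andbF.
elim: s => [|b s IH].
  by rewrite completion0 !count_cat !count_nseq !mul1n !mul0n addn0 add0n eqxx.
rewrite cat_cons completion_cons; last by rewrite -cat_cons nall.
case: b => /=; first by rewrite IH.
case e: (count id s) => [|n]; last by rewrite /= -e IH.
have zs : s = nseq (size s) false by elim: (s) e => //= -[] u IHu // /IHu {1}->.
rewrite add0n -[false :: nseq r false ++ _]/(nseq r.+1 false ++ _) completion0
  !count_cat !count_nseq e !mul1n !mul0n addn0 !add0n.
have -> : count negb s = size s by rewrite count_negb e subn0.
by move: zs; set n := size s => ->; rewrite catA -nseqD eqxx.
Qed.

(** Zeros beyond the stock are allowed only after the stock of ones is exhausted, and from then on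
    [y] must consist of zeros followed by ones. *)
Lemma completion_over p q y u : (p <= count id y)%N -> (q < count negb y)%N ->
  completion p q y = Some u ->
  [/\ count id u = p, count negb u = q &
      y = u ++ nseq (count negb y - q) false ++ nseq (count id y - p) true].
Proof.
elim: y p q u => [|b y IH] p q u py yq //.
have [al|nal] := boolP (all id (b :: y)).
  by move: yq; have [_ ->] := count_id_all al.
case: p py => [|p] py.
  rewrite completion0; case: ifP => // /eqP ey [<-].
  rewrite !count_nseq mul0n mul1n subn0; split=> //.
  by rewrite catA -nseqD subnKC // ltnW.
rewrite completion_cons //; case: b nal py yq => /= nal py yq.
  case ec: completion => [u'|] //= -[<-].
  by have [s1 s2 e1] := IH _ _ _ py yq ec; split; rewrite /= ?s1 ?s2 // subSS -e1.
case: q yq => // q yq; case ec: completion => [u'|] //= -[<-].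
have [s1 s2 e1] := IH _ _ _ py yq ec.
by split; rewrite /= ?s1 ?s2 // subSS -e1.
Qed.

(** * Reversal of the Pieri operator *)

Section PieriRev.
Variables (R : comPzRingType) (z : R).

(** Leaving the final flag free makes the product symmetric under reversal. *)
Fixpoint pieri_end (c c' : bool) (s t : seq bool) : R :=
  match s, t with
  | v :: s', v' :: t' => pieri_wt z c v v' * pieri_end (pieri_next c v v') c' s' t'
  | _, _ => (c == c')%:R
  end.

Lemma pieri_endE c s t : size s = size t -> pieri z c s t = pieri_end c false s t.
Proof.
elim: s t c => [|v s IH] [|v' t] c //=; first by case: c.
by case=> sz; rewrite IH.
Qed.

Definition pieri_step c v v' d : R := pieri_wt z c v v' * (pieri_next c v v' == d)%:R.

Lemma pieri_end_cons c c' v v' s t :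
  pieri_end c c' (v :: s) (v' :: t) =
  \sum_d pieri_step c v v' d * pieri_end d c' s t.
Proof.
rewrite sum_bool /pieri_step /=.
by case: (pieri_next c v v'); rewrite !(mulr1, mulr0, mul0r, addr0, add0r).
Qed.

Lemma pieri_end_rcons c c' v v' s t : size s = size t ->
  pieri_end c c' (rcons s v) (rcons t v') =
  \sum_d pieri_end c d s t * pieri_step d v v' c'.
Proof.
elim: s t c => [|a s IH] [|b t] c // => [_|[sz]].
  rewrite [rcons _ _]/= [rcons _ _]/= /= sum_bool /pieri_step.
  by case: c; rewrite !(mulr1, mulr0, mul0r, mul1r, addr0, add0r).
rewrite !rcons_cons !pieri_end_cons.
under eq_bigr => d _ do rewrite IH // mulr_sumr.
rewrite exchange_big; apply: eq_bigr => d _ /=.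
rewrite -[_ * pieri_end _ _ _ _]/(pieri_end c d (a :: s) (b :: t)) pieri_end_cons
  mulr_suml.
by apply: eq_bigr => d' _; rewrite mulrA.
Qed.

Lemma pieri_end_rev c c' s t : size s = size t ->
  pieri_end c c' s t = pieri_end c' c (rev t) (rev s).
Proof.
elim: s t c => [|v s IH] [|v' t] c // => [_|[sz]]; first by rewrite /= eq_sym.
rewrite !rev_cons pieri_end_cons pieri_end_rcons ?size_rev //.
apply: eq_bigr => d _; rewrite IH // mulrC; congr (_ * _).
(* A single step read backwards exchanges its two letters and its two flags. *)
by case: c v v' d => [] [] [] [];
  rewrite /pieri_step /pieri_wt /= !(mulr1, mulr0, mul0r, mul1r).
Qed.

Lemma pieri_rev s t : size s = size t ->
  pieri z false s t = pieri z false (rev t) (rev s).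
Proof. by move=> sz; rewrite !pieri_endE ?size_rev // pieri_end_rev. Qed.

End PieriRev.

Lemma sum_rev (V : nmodType) n (F : seq bool -> V) :
  \sum_(s : n.-tuple bool) F s = \sum_(s : n.-tuple bool) F (rev s).
Proof.
rewrite (reindex (fun s : n.-tuple bool => [tuple of rev s])) //=.
by exists (fun s : n.-tuple bool => [tuple of rev s]) => s _;
  apply/val_inj; rewrite /= revK.
Qed.

(** * Expansion of Par in both pairs of sides *)

Section ParExpansion.
Variables a0 a1 c0 c1 : nat.
Local Notation a := (a0 + a1)%N.
Local Notation c := (c0 + c1)%N.
Implicit Types alpha beta gamma delta : seq bool.

Let ParZ alpha gamma beta delta : int := (Par a c alpha gamma beta delta)%:Z.

Let ParZ_polyC alpha gamma beta delta :
  size alpha = a -> size gamma = c -> size delta = c ->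
  (ParZ alpha gamma beta delta)%:P =
  puzzle_sum {poly int} gamma (rev delta) (rev alpha) beta.
Proof. by move=> sa sg sd; rewrite -(@Par_sum _ a c) // /ParZ -natz rmorph_nat. Qed.

Lemma Par_expand_base alpha beta gamma delta :
  alpha \in binstr a a1 -> beta \in binstr a a1 ->
  size gamma = c -> size delta = c ->
  ParZ alpha gamma beta delta =
  \sum_(nu : a.-tuple bool | tval nu \in binstr a a1)
    lr_str a1 alpha beta nu * ParZ (unit_str a a1) gamma nu delta.
Proof.
move=> ha hb sg sd; apply: (lr_of_adjoint (Q := fun s t => ParZ s gamma t delta)) => //.
move=> s t cs ct.
have X0 : 'X != 0 :> {poly int} by rewrite polyX_eq0.
have szr : size gamma = size (rev delta) by rewrite size_rev sg sd.
have := @puzzle_sum_pieri _ 'X gamma (rev delta) (rev s) t X0 szr.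
rewrite size_rev !size_tuple count_rev cs ct => /(_ erefl erefl) e.
transitivity (\sum_(s' : a.-tuple bool) pieri 'X false (rev s) s' *
    puzzle_sum {poly int} gamma (rev delta) s' t).
  rewrite [RHS](sum_rev _ (fun s' : seq bool => pieri 'X false (rev s) s' * puzzle_sum
    _ _ _ s' _)).
  apply: eq_bigr => s' _; rewrite ParZ_polyC ?size_tuple // -pieri_rev //.
  by rewrite !size_tuple.
rewrite e; apply: eq_bigr => t' _.
by rewrite ParZ_polyC ?size_tuple // mulrC.
Qed.

Lemma Par_expand_side alpha gamma beta delta :
  size alpha = a -> gamma \in binstr c c1 -> delta \in binstr c c1 ->
  ParZ alpha gamma beta delta =
  \sum_(ka : c.-tuple bool | tval ka \in binstr c c1)
    lr_str c1 gamma delta ka * ParZ alpha (unit_str c c1) beta ka.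
Proof.
move=> sa hg hd; apply: (lr_of_adjoint (Q := fun s t => ParZ alpha s beta t)) => //.
move=> s t cs ct.
have sz : size s = size (rev t) by rewrite size_rev !size_tuple.
have := puzzle_sum_pieri_side ('X : {poly int}) (rev alpha) beta sz.
rewrite size_rev !size_tuple => e.
transitivity (\sum_(s' : c.-tuple bool) pieri 'X false s' s *
    puzzle_sum {poly int} s' (rev t) (rev alpha) beta).
  by apply: eq_bigr => s' _; rewrite ParZ_polyC ?size_tuple.
rewrite e (sum_rev _ (fun s' : seq bool => pieri 'X false (rev t) s' * puzzle_sum _ _
  s' _ _)).
apply: eq_bigr => t' _; rewrite ParZ_polyC ?size_tuple // -pieri_rev //.
by rewrite !size_tuple.
Qed.

(** Read from the west corner, the identity string on SW is 1^a1 0^a0, so the rows start with [s1]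
    and [s2] empty. *)
Lemma Par_units (nu ka : seq bool) : size nu = a -> ka \in binstr c c1 ->
  ParZ (unit_str a a1) (unit_str c c1) nu ka =
  (completion a1 a0 (rev ka) == Some nu)%:R.
Proof.
move=> sb; rewrite inE => /andP[/eqP sd /eqP cd].
have unitE m n : unit_str (m + n) n = nseq m false ++ nseq n true.
  by rewrite /unit_str addnK.
rewrite /ParZ -natz (@Par_sum int) ?size_cat ?size_nseq ?addnK //.
rewrite !unitE rev_cat !rev_nseq /puzzle_sum.
have cnt : count negb (rev ka) = (c0 + count id [::])%N.
  by rewrite count_negb size_rev count_rev sd cd addnK addn0.
have sz : size (rev ka) = (c0 + c1)%N by rewrite size_rev.
have := stack_completion (s1 := [::]) a1 a0 (@dirac int (labels nu)) sz cnt (implybT _).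
rewrite /= => ->; case: completion => [t|]; last by [].
by rewrite /dirac; congr (nat_of_bool _)%:R; apply: inj_eq; apply: inj_map => ? ? [].
Qed.

End ParExpansion.

Lemma sum_pick n k (x : seq bool) (F : seq bool -> int) : x \in binstr n k ->
  \sum_(t : n.-tuple bool | tval t \in binstr n k) (tval t == x)%:R * F t = F x.
Proof.
move=> hx; have [sx _] := andP (hx : (size x == n) && (count id x == k)).
rewrite (bigD1 (Tuple sx)) //= eqxx mul1r big1 ?addr0 // => t /andP[_].
by rewrite -val_eqE /= => /negPf ->; rewrite mul0r.
Qed.

(** The pairs related by [b] are the (f x, g x), and injectivity of [g] ensures that each is counted
    once. *)
Lemma sum_graph n k n1 k1 n2 k2 (f g : seq bool -> seq bool)
    (b : seq bool -> seq bool -> bool) (A B : seq bool -> int) :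
  (forall x, x \in binstr n k ->
    [/\ f x \in binstr n1 k1, g x \in binstr n2 k2 & b (f x) (g x)]) ->
  (forall u v, u \in binstr n1 k1 -> v \in binstr n2 k2 -> b u v ->
    exists2 x, x \in binstr n k & u = f x /\ v = g x) ->
  {in binstr n k &, injective g} ->
  \sum_(u : n1.-tuple bool | tval u \in binstr n1 k1) A u *
    \sum_(v : n2.-tuple bool | tval v \in binstr n2 k2) B v * (b u v)%:R =
  \sum_(x : n.-tuple bool | tval x \in binstr n k) A (f x) * B (g x).
Proof.
move=> fgP exP g_inj.
transitivity (\sum_(u : n1.-tuple bool | tval u \in binstr n1 k1)
  \sum_(v : n2.-tuple bool | tval v \in binstr n2 k2)
  \sum_(x : n.-tuple bool | tval x \in binstr n k)
    (tval u == f x)%:R * ((tval v == g x)%:R * (A u * B v))).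
  apply: eq_bigr => u hu; rewrite mulr_sumr; apply: eq_bigr => v hv.
  under eq_bigr => x _ do rewrite mulrA.
  rewrite -mulr_suml [_ * (A u * B v)]mulrC mulrA; congr (_ * _).
  case: (boolP (b u v)) => [buv|nbuv].
    have [x hx [eu ev]] := exP _ _ hu hv buv.
    rewrite eu ev -[LHS](sum_pick (fun=> 1) hx); apply: eq_bigr => y hy.
    rewrite mulr1; have [e|ne] := eqVneq (tval y) x; first by rewrite e !eqxx.
    rewrite (_ : (g x == g y) = false) ?mulr0 //; apply: contra_neqF ne => /eqP e.
    by apply/esym/g_inj.
  rewrite big1 // => x hx; have [_ _ bx] := fgP _ hx.
  case: eqP => [eu|_]; last by rewrite mul0r.
  by case: eqP => [ev|_]; rewrite ?mulr0 //; case/negP: nbuv; rewrite eu ev.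
under eq_bigr => u _ do rewrite exchange_big.
rewrite exchange_big; apply: eq_bigr => x hx /=; have [hf hg _] := fgP _ hx.
under eq_bigr => u _ do rewrite -mulr_sumr (sum_pick (fun v => A u * B v) hg).
exact: (sum_pick (fun u => A u * B (g x)) hf).
Qed.

Lemma Par_expansion a0 a1 c0 c1 alpha beta gamma delta :
  alpha \in binstr (a0 + a1) a1 -> beta \in binstr (a0 + a1) a1 ->
  gamma \in binstr (c0 + c1) c1 -> delta \in binstr (c0 + c1) c1 ->
  (Par (a0 + a1) (c0 + c1) alpha gamma beta delta)%:Z =
  \sum_(nu : (a0 + a1).-tuple bool | tval nu \in binstr (a0 + a1) a1)
    lr_str a1 alpha beta nu *
    \sum_(ka : (c0 + c1).-tuple bool | tval ka \in binstr (c0 + c1) c1)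
      lr_str c1 gamma delta ka * (completion a1 a0 (rev ka) == Some (tval nu))%:R.
Proof.
move=> ha hb hg hd.
have sz n k (s : seq bool) : s \in binstr n k -> size s = n by case/andP=> /eqP.
rewrite (Par_expand_base ha hb) ?(sz _ _ _ hg) ?(sz _ _ _ hd) //.
apply: eq_bigr => nu hnu; congr (_ * _).
have su : size (unit_str (a0 + a1) a1) = (a0 + a1)%N.
  by rewrite /unit_str addnK size_cat !size_nseq.
rewrite (Par_expand_side _ su hg hd); apply: eq_bigr => ka hka; congr (_ * _).
by rewrite Par_units ?size_tuple.
Qed.

Lemma binstrE n k s : (s \in binstr n k) = (size s == n) && (count id s == k).
Proof. by []. Qed.

Lemma binstr_rev n k s : (rev s \in binstr n k) = (s \in binstr n k).
Proof. by rewrite !binstrE size_rev count_rev. Qed.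

Lemma binstr_zeros n k (s : seq bool) : s \in binstr (n + k) k -> count negb s = n.
Proof. by rewrite binstrE count_negb => /andP[/eqP -> /eqP ->]; rewrite addnK. Qed.

Theorem theorem3 (a0 a1 c0 c1 : nat) (alpha beta gamma delta : seq bool)
  (halpha : alpha \in binstr (a0 + a1) a1)
  (hbeta : beta \in binstr (a0 + a1) a1)
  (hgamma : gamma \in binstr (c0 + c1) c1)
  (hdelta : delta \in binstr (c0 + c1) c1) :
  [/\ (c0 <= a0)%N -> (c1 < a1)%N ->
      (Par (a0 + a1) (c0 + c1) alpha gamma beta delta)%:Z =
      \sum_(mu : (c0 + c1).-tuple bool | tval mu \in binstr (c0 + c1) c1)
        lr_str a1 alpha beta (mu ++ nseq (a1 - c1) true ++ nseq (a0 - c0) false)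
        * lr_str c1 gamma delta (rev mu),
      (a1 <= c1)%N -> (a0 < c0)%N ->
      (Par (a0 + a1) (c0 + c1) alpha gamma beta delta)%:Z =
      \sum_(la : (a0 + a1).-tuple bool | tval la \in binstr (a0 + a1) a1)
        lr_str a1 alpha beta (rev la)
        * lr_str c1 gamma delta
            (nseq (c1 - a1) true ++ nseq (c0 - a0) false ++ la),
      (c0 <= a0)%N -> (a1 <= c1)%N ->
      (Par (a0 + a1) (c0 + c1) alpha gamma beta delta)%:Z =
      \sum_(eta : (c0 + a1).-tuple bool | tval eta \in binstr (c0 + a1) a1)
        lr_str a1 alpha beta (rev eta ++ nseq (a0 - c0) false)
        * lr_str c1 gamma delta (nseq (c1 - a1) true ++ eta)
    & (a0 < c0)%N -> (c1 < a1)%N ->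
      Par (a0 + a1) (c0 + c1) alpha gamma beta delta = 0%N].

Proof.
rewrite (Par_expansion halpha hbeta hgamma hdelta).
pose A nu := lr_str a1 alpha beta nu; pose B ka := lr_str c1 gamma delta ka.
pose b u v := completion a1 a0 (rev v) == Some u.
split=> h0 h1.
(* The stock covers all of [rev ka], and what is left of it forms the constant tail. *)
- apply: (sum_graph (f := fun mu => mu ++ nseq (a1 - c1) true ++ nseq (a0 - c0) false)
    (g := rev) (b := b) A B) => [mu hmu|u v hu hv /eqP e|u v _ _ /(can_inj revK) //].
    have := binstr_zeros hmu; move: (hmu); rewrite binstrE => /andP[/eqP sm /eqP cm] zm.
    rewrite binstr_rev hmu binstrE !size_cat !count_cat !size_nseq !count_nseq sm cm.
    by rewrite /b revK completion_short ?cm // zm h0 eqxx; split=> //; lia.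
  exists (rev v); first by rewrite binstr_rev.
  have := binstr_zeros hv; move: hv; rewrite binstrE => /andP[_ /eqP cv] zv;
    rewrite revK; split=> //.
  move: e; rewrite completion_short ?count_rev ?cv // zv h0 => -[<-] //.
- apply: (sum_graph (f := rev)
    (g := fun la => nseq (c1 - a1) true ++ nseq (c0 - a0) false ++ la) (b := b) A B) =>
      [la hla|u v hu hv /eqP e|u v hu hv].
  + have := binstr_zeros hla; move: (hla); rewrite binstrE => /andP[/eqP sm /eqP cm] zm.
    rewrite binstr_rev hla binstrE !size_cat !count_cat !size_nseq !count_nseq sm cm.
    split=> //; first by lia.
    rewrite /b !rev_cat !rev_nseq -catA.
    (* The strict inequality of this case provides the nonempty block of zeros. *)
    have -> : (c0 - a0 = (c0 - a0).-1.+1)%N by lia.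
    by rewrite -[in completion _ _ _]cm -{1}zm -(count_rev id) -(count_rev negb)
      completion_cat_zeros.
  + have := binstr_zeros hv; move: hv; rewrite binstrE => /andP[_ /eqP cv] zv.
    have := completion_over (u := u) (y := rev v) (p := a1) (q := a0).
    rewrite !count_rev cv zv => /(_ h0 h1 e)[_ _ ev].
    exists (rev u); first by rewrite binstr_rev.
    by rewrite revK; split=> //; rewrite -[v]revK ev !rev_cat !rev_nseq catA.
  by move/eqP; rewrite !catA eqseq_cat // => /andP[_ /eqP].
(* The surplus ones lie on the side of [ka] and the surplus zeros on that of [nu]; [eta] is the
   common part, up to reversal. *)
- apply: (sum_graph (f := fun eta => rev eta ++ nseq (a0 - c0) false)
    (g := fun eta => nseq (c1 - a1) true ++ eta) (b := b) A B) => [et het|u v hu hv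
      /eqP e|u v hu hv].
  + have := binstr_zeros het; move: (het); rewrite binstrE => /andP[/eqP sm /eqP cm] zm.
    rewrite !binstrE !size_cat !count_cat size_rev count_rev !size_nseq !count_nseq sm
      cm.
    split; [lia|lia|].
    rewrite /b rev_cat rev_nseq completion_cat_ones ?count_rev ?cm ?zm //.
  + have := binstr_zeros hv; move: hv; rewrite binstrE => /andP[/eqP sv /eqP cv] zv.
    have := completion_long (u := u) (y := rev v) (p := a1) (q := a0).
    rewrite !count_rev cv zv => /(_ h1 h0 e)[s [cs zs] [ev eu]].
    exists (rev s); first by rewrite binstr_rev binstrE cs -(count_predC id s) cs zs
      addnC !eqxx.
    by rewrite revK; split=> //; rewrite -[v]revK ev rev_cat rev_nseq.
  by move/eqP; rewrite eqseq_cat // => /andP[_ /eqP].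
(* There are ones to spare but too few zeros, so every completion fails. *)
apply/eqP; rewrite -eqz_nat Par_expansion //; apply/eqP.
rewrite big1 // => nu _; rewrite big1 ?mulr0 // => ka hka.
have := binstr_zeros hka; move: hka; rewrite binstrE => /andP[_ /eqP ck] zk.
by rewrite completion_short ?count_rev ?ck // zk leqNgt h0 mulr0.
Qed.
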